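(* It holds that $c_{2,4}=5/2$. That is, $5/2$ is the least constant $c$ such that, for every $n\ge 1$, every $n$-vertex graph with at least $c\cdot n$ edges contains a cycle whose length is congruent to $2$ modulo $4$.
   Context: All graphs are finite, undirected and simple. For integers $k>\ell\ge 0$ such that the congruence class $\ell \pmod k$ contains some even integers, $c_{\ell,k}$ denotes the least constant such that every $n$-vertex graph with at least $c_{\ell,k}\cdot n$ edges contains a cycle of length $\ell$ modulo $k$. *)

(* Defs.v *)
From HB Require Import structures.
From mathcomp Require Import all_boot all_order all_algebra.
From mathcomp Require Import reals.

Set Implicit Arguments.
Unset Strict Implicit.
Unset Printing Implicit Defensive.

Import Order.TTheory GRing.Theory Num.Theory.

Local Open Scope ring_scope.

Record sgraph := SGraph {
  vertex :> finType;
  adj : rel vertex;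
  adj_sym : symmetric adj;
  adj_irrefl : irreflexive adj }.

Definition edges (G : sgraph) : {set {set G}} :=
  [set [set p.1; p.2] | p in [set p : G * G | adj p.1 p.2]].

(* [ucycle] also accepts the empty sequence and, the relation being symmetric,
   the closed walk x, y along a single edge; the bound on the size excludes
   both. The length of a cycle is its number of vertices. *)
Definition is_cycle (G : sgraph) (s : seq G) : Prop :=
  ucycle (@adj G) s /\ (3 <= size s)%N.

Definition has_cycle_mod (l k : nat) (G : sgraph) : Prop :=
  exists2 s : seq G, is_cycle s & size s = l %[mod k].

Definition forces_cycle_mod (R : realType) (l k : nat) (c : R) : Prop :=
  forall (n : nat) (G : sgraph), (1 <= n)%N -> #|G| = n ->
    c * n%:R <= #|edges G|%:R -> has_cycle_mod l k G.

(* A minimum, not an infimum: c itself must force a cycle. *)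
Definition is_cycle_mod_constant (R : realType) (l k : nat) (c : R) : Prop :=
  forces_cycle_mod l k c /\
  forall c' : R, forces_cycle_mod l k c' -> c <= c'.

(* Main.v *)
Require Import Defs.
From HB Require Import structures.
From mathcomp Require Import all_boot all_order all_algebra.
From mathcomp Require Import reals zify lra.
From Stdlib Require Import Classical.

Set Implicit Arguments.
Unset Strict Implicit.
Unset Printing Implicit Defensive.

Import Order.TTheory GRing.Theory Num.Theory.

(* Lower bound: copies of K_5 glued at a common vertex have 4t+1 vertices, 10t
   edges and no cycle longer than 5.

   Upper bound: in a minimal counterexample every degree is at least 3 and
   vertices of degree 3 are pairwise nonadjacent.  Among all longest paths
   v_0 v_1 ... take one whose first vertex has a neighbour v_b as far along the
   path as possible.  If a Hamiltonian path of the cycle C = v_0 ... v_b ends in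
   v_b, then all neighbours of its other end lie on C.  A single chord of C, and
   every crossing, nested or disjoint pair of chords, excludes residues modulo 4,
   and this leaves two configurations only: either b = 4 and v_0, ..., v_3 have
   no neighbour outside {v_0, ..., v_4}, or there are "twins" p, q of degree 3
   with two common neighbours x, y whose third neighbours p', q' are joined by a
   path avoiding p, q, x, y.  In the first case delete v_0, ..., v_3, which
   destroys at most 10 edges.  In the second, delete p and q, and then identify
   p' with q' (losing 3 vertices and at most 7 edges in all) or, if
   p' = q', identify x, y and p' (losing 4 vertices and at most 9 edges).
   Rerouting through the twins shows that no path whose length is 2 modulo 4
   joins two identified vertices, so no cycle of such length is created. *)

(* A path whose vertices are named by indices 0, ..., b with i adjacent to i.+1 is
   a list of index pairs (i, k), each standing for the run from i to k, upwards
   or downwards; consecutive runs are joined by chords.  Length, disjointness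
   and range of such a walk are linear arithmetic in the end points. *)
Definition seg (i j : nat) : seq nat :=
  if i <= j then iota i (j - i).+1 else rev (iota j (i - j).+1).

Definition walk (l : seq (nat * nat)) : seq nat := flatten [seq seg p.1 p.2 | p <- l].

Fixpoint chain (E : rel nat) (j : nat) (l : seq (nat * nat)) : Prop :=
  if l is (i, k) :: l' then E j i /\ chain E k l' else True.

Fixpoint apart (i k : nat) (l : seq (nat * nat)) : Prop :=
  if l is (i', k') :: l' then
    (maxn i k < minn i' k' \/ maxn i' k' < minn i k) /\ apart i k l'
  else True.

Fixpoint allapart (l : seq (nat * nat)) : Prop :=
  if l is (i, k) :: l' then apart i k l' /\ allapart l' else True.

Fixpoint within (b : nat) (l : seq (nat * nat)) : Prop :=
  if l is (i, k) :: l' then (maxn i k <= b) /\ within b l' else True.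

Fixpoint wsize (l : seq (nat * nat)) : nat :=
  if l is (i, k) :: l' then (maxn i k - minn i k).+1 + wsize l' else 0.

Lemma mem_seg i j x : (x \in seg i j) = (minn i j <= x <= maxn i j).
Proof. rewrite /seg; case: leqP => h; rewrite ?mem_rev mem_iota; lia. Qed.

Lemma size_seg i j : size (seg i j) = (maxn i j - minn i j).+1.
Proof. rewrite /seg; case: leqP => h; rewrite ?size_rev size_iota; lia. Qed.

Lemma seg_uniq i j : uniq (seg i j).
Proof. by rewrite /seg; case: ifP => _; rewrite ?rev_uniq iota_uniq. Qed.

Lemma size_walk l : size (walk l) = wsize l.
Proof. by elim: l => // -[i k] l IH /=; rewrite /walk /= size_cat size_seg -IH. Qed.

Lemma apart_walk i k l : apart i k l -> forall x, x \in walk l -> x \notin seg i k.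
Proof.
elim: l => // -[i' k'] l IH /= [h1 h2] x; rewrite /walk /= mem_cat => /orP[]; last exact: IH.
by rewrite !mem_seg; lia.
Qed.

Lemma walk_uniq l : allapart l -> uniq (walk l).
Proof.
elim: l => // -[i k] l IH /= [h1 h2].
rewrite /walk /= cat_uniq seg_uniq -/(walk l) IH // andbT /=.
apply/hasPn => x xl; exact: (apart_walk h1 xl).
Qed.

Lemma walk_within b l x : within b l -> x \in walk l -> x <= b.
Proof.
elim: l => // -[i k] l IH /= [h1 h2]; rewrite /walk /= mem_cat => /orP[]; last exact: IH.
rewrite mem_seg; lia.
Qed.

Section Walk.
Variables (b : nat) (E : rel nat).
Hypothesis Esym : symmetric E.
Hypothesis Estep : forall i, i < b -> E i i.+1.

Lemma seg_path i j : i <= b -> j <= b ->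
  exists s, [/\ seg i j = i :: s, path E i s & last i s = j].
Proof.
move=> ib jb; rewrite /seg; case: leqP => h.
  have -> : j = i + (j - i) by lia.
  have : i + (j - i) <= b by lia.
  move: (j - i) => n; rewrite addKn => nb {h jb}.
  exists (iota i.+1 n); split => //=.
    elim: n i nb {ib} => //= n IH i nb; rewrite Estep ?IH //; lia.
  elim: n i nb {ib} => /= [|n IH] i nb; first by lia.
  rewrite IH; lia.
have {ib jb} : j + (i - j) <= b by lia.
have -> : i = j + (i - j) by lia.
rewrite addKn; move: (i - j) => n nb {h i}.
exists (rev (iota j n)); rewrite -{1}addn1 iotaD rev_cat /=; split=> //.
  elim: n nb => [//|n IH] nb; rewrite -{2}[n.+1]addn1 iotaD rev_cat /= Esym addnS Estep ?IH //; lia.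
by case: n nb => [|n] nb /=; [rewrite addn0 | rewrite rev_cons last_rcons].
Qed.

Lemma walk_path i k l : within b ((i, k) :: l) -> chain E k l ->
  exists s, [/\ walk ((i, k) :: l) = i :: s, path E i s & last i s = last k [seq p.2 | p <- l]].
Proof.
elim: l i k => [|[i' k'] l IH] i k.
  move=> [h _] _; have [||s [h1 h2 h3]] := @seg_path i k; [lia|lia|].
  by exists s; rewrite /walk /= cats0.
move=> [h hw] /= [hE hc].
have [||s [h1 h2 h3]] := @seg_path i k; [lia|lia|].
have [s' [g1 g2 g3]] := IH i' k' hw hc.
exists (s ++ i' :: s'); split.
- by rewrite /walk /= h1 /=; congr (_ :: _ ++ _); rewrite -g1.
- by rewrite cat_path h2 h3 /= hE.
- by rewrite last_cat h3 /= g3.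
Qed.
End Walk.

(** * Chords of the cycle 0, ..., b *)

Section Lollipop.
Variables (w b : nat) (E : rel nat).
Hypothesis bw : b = w.+1.
Hypothesis Esym : symmetric E.
Hypothesis Eirr : irreflexive E.
Hypothesis Estep : forall i, i < b -> E i i.+1.
Hypothesis Eclose : E 0 b.
Hypothesis w2 : 2 <= w.
Hypothesis nocyc : forall s : seq nat, uniq s -> all (fun i => i <= b) s -> cycle E s ->
  2 < size s -> size s %% 4 <> 2.

(** Replacing the start of a longest path, up to index [b], by such a Hamiltonian path gives again a
    longest path. Hence only these vertices [t] are known to have all their neighbours on the
    cycle. *)
Definition hampath_end (t : nat) :=
  exists s : seq nat, [/\ perm_eq (t :: s) (iota 0 b.+1), path E t s & last t s = b].
Notation T := hampath_end.
Definition deg4 (t : nat) := forall a1 a2 a3 : nat, exists c : nat, [/\ c <= b, E t c, c <> a1, c <> a2 & c <> a3].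

Hypothesis end_deg3 : forall t : nat, T t -> forall a1 a2 : nat, exists c : nat, [/\ c <= b, E t c, c <> a1 & c <> a2].
Hypothesis end_adj_deg4 : forall t t' : nat, T t -> T t' -> E t t' -> deg4 t \/ deg4 t'.

Lemma E_consecutive i j : j = i.+1 \/ i = j.+1 -> i <= b -> j <= b -> E i j.
Proof. by case=> -> h1 h2; [|rewrite Esym]; apply: Estep. Qed.

Lemma E_neq i j : E i j -> i <> j.
Proof. by move=> h e; rewrite e Eirr in h. Qed.

Lemma cycle_of_walk i k l : within b ((i, k) :: l) -> chain E k l ->
  E (last k [seq p.2 | p <- l]) i -> allapart ((i, k) :: l) ->
  2 < wsize ((i, k) :: l) -> wsize ((i, k) :: l) %% 4 <> 2.
Proof.
move=> h1 h2 h3 h4; rewrite -size_walk; apply: nocyc; first exact: walk_uniq.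
  by apply/allP => x; apply: walk_within h1.
have [s [-> g2 g3]] := walk_path Esym Estep h1 h2.
by rewrite /= rcons_path g2 g3 h3.
Qed.

Lemma hampath_end_of_walk i k l : within b ((i, k) :: l) -> chain E k l ->
  last k [seq p.2 | p <- l] = b -> allapart ((i, k) :: l) ->
  wsize ((i, k) :: l) = b.+1 -> T i.
Proof.
move=> h1 h2 h3 h4 h5.
have [s [g1 g2 g3]] := walk_path Esym Estep h1 h2.
exists s; split; rewrite ?g3 // -g1; apply: uniq_perm; rewrite ?iota_uniq ?walk_uniq //.
have u := walk_uniq h4.
have sz : size (walk ((i, k) :: l)) = b.+1 by rewrite size_walk h5.
have sub : {subset walk ((i, k) :: l) <= iota 0 b.+1}.
  move=> x /(walk_within h1); rewrite mem_iota; lia.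
by have [] := uniq_min_size u sub; rewrite ?size_iota ?sz.
Qed.

(* Hypotheses about residues or adjacency are cleared because they slow lia down. *)
Ltac elia := repeat match goal with H : context [E] |- _ => clear H end; lia.
Ltac olia := repeat match goal with H : context [_ %% _] |- _ => clear H end;
  repeat match goal with H : context [E] |- _ => clear H end; lia.
Ltac adj := first [ assumption | rewrite Esym; assumption
  | apply: E_consecutive; olia
  | match goal with H : is_true (E ?x ?y) |- is_true (E ?z ?t) =>
      (replace z with x by olia; replace t with y by olia; exact H) end
  | match goal with H : is_true (E ?x ?y) |- is_true (E ?z ?t) =>
      (replace t with x by olia; replace z with y by olia; rewrite Esym; exact H) end ].
Ltac cyc i k l := let H := fresh "cy" in
  assert (H := @cycle_of_walk i k l); cbn [within chain allapart apart wsize map last fst snd] in H;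
  match type of H with ?A -> ?B -> ?C -> ?D -> ?F -> ?G =>
    let x := fresh in
    assert (x : G) by (apply: H; [repeat split; olia | repeat split; adj | adj | repeat split; olia | olia]);
    clear H; move: x => H end.
Ltac ends i k l := apply: (@hampath_end_of_walk i k l); cbn [within chain allapart apart wsize map last fst snd];
   [repeat split; olia | repeat split; adj | olia | repeat split; olia | olia].

(** The two conditions come from the two cycles formed by the chord with either arc. *)
Lemma chord_mod4 x y : E x y -> x.+2 <= y <= b ->
  y %% 4 <> x.+1 %% 4 /\ (0 < x \/ y < b -> (b + x) %% 4 <> y %% 4).
Proof.
move=> h xy; split; first by cyc x y (@nil (nat*nat)); lia.
move=> ne; cyc y b [:: (0, x)]; lia.
Qed.

(** Crossing chords cut the cycle into four arcs; each pair of opposite arcs closes up with the two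
    chords. *)
Lemma crossing_mod4 x y x' y' : E x y -> E x' y' -> x < x' -> x' < y -> y < y' -> y' <= b ->
  (x' + y') %% 4 <> (x + y) %% 4 /\ (x + y + b).+1 %% 4 <> (x' + y') %% 4.
Proof.
move=> h h' *; split; first by cyc x x' [:: (y', y)]; lia.
by cyc x' y [:: (x, 0); (b, y')]; lia.
Qed.

(** Chords that do not cross lie on one common cycle, completed by the two arcs between them. In the
    nested case these arcs avoid the edge [0 b]; in the disjoint case below one of them contains
    it. *)
Lemma nested_mod4 x y x' y' : E x y -> E x' y' -> x <= x' -> x' < y' -> y' <= y -> y <= b ->
  x <> x' \/ y <> y' -> (x' + y) %% 4 <> (x + y') %% 4.
Proof. by move=> h h' *; cyc x x' [:: (y', y)]; lia. Qed.

Lemma disjoint_mod4 x y x' y' : E x y -> E x' y' -> x < y -> y <= x' -> x' < y' -> y' <= b ->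
  (x' + b + x).+1 %% 4 <> (y + y') %% 4.
Proof. by move=> h h' *; cyc y x' [:: (y', b); (0, x)]; lia. Qed.

Lemma cycle_mod : b.+1 %% 4 <> 2.
Proof. by cyc 0 b (@nil (nat*nat)); lia. Qed.

Lemma mod4_cases x : x %% 4 = 0 \/ x %% 4 = 1 \/ x %% 4 = 2 \/ x %% 4 = 3.
Proof. lia. Qed.

Lemma chord_contra x y a c d : E x y -> x %% 4 = a -> y %% 4 = c -> b %% 4 = d ->
  (c == a.+1 %% 4) || ((d + a) %% 4 == c) ->
  x.+2 <= y -> y <= b -> 0 < x \/ y < b -> False.
Proof.
move=> h <- <- <- r h1 h2 h3.
have [e1 /(_ h3) e2] := @chord_mod4 x y h ltac:(elia).
case/orP: r => /eqP r; [apply: e1|apply: e2].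
  by rewrite r -(addn1 (x %% 4)) modnDml addn1.
by rewrite -r modnDm.
Qed.

Lemma succ_add3_mod4 x y d : (x %% 4 + y %% 4 + d %% 4).+1 %% 4 = (x + y + d).+1 %% 4.
Proof.
rewrite -(addn1 (_ + d %% 4)) -(addn1 (x + y + d)); apply/eqP; rewrite eqn_modDr; apply/eqP.
by rewrite modnDmr -addnA modnDml addnCA modnDml addnCA addnA.
Qed.

Lemma crossing_contra x y x' y' a c a' c' d : E x y -> E x' y' ->
  x %% 4 = a -> y %% 4 = c -> x' %% 4 = a' -> y' %% 4 = c' -> b %% 4 = d ->
  ((a' + c') %% 4 == (a + c) %% 4) || ((a + c + d).+1 %% 4 == (a' + c') %% 4) ->
  x < x' -> x' < y -> y < y' -> y' <= b -> False.
Proof.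
move=> h h' <- <- <- <- <- r h1 h2 h3 h4.
have [e1 e2] := crossing_mod4 h h' h1 h2 h3 h4.
case/orP: r => /eqP r; [apply: e1|apply: e2].
  by rewrite -modnDm r modnDm.
by rewrite -modnDm -r succ_add3_mod4.
Qed.

Lemma nested_contra x y x' y' a c a' c' : E x y -> E x' y' ->
  x %% 4 = a -> y %% 4 = c -> x' %% 4 = a' -> y' %% 4 = c' ->
  (a' + c) %% 4 == (a + c') %% 4 ->
  x <= x' -> x' < y' -> y' <= y -> y <= b -> x <> x' \/ y <> y' -> False.
Proof.
move=> h h' <- <- <- <- /eqP r h1 h2 h3 h4 h5; apply: (nested_mod4 h h' h1 h2 h3 h4 h5).
by rewrite -modnDm r modnDm.
Qed.

Lemma disjoint_contra x y x' y' a c a' c' d : E x y -> E x' y' ->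
  x %% 4 = a -> y %% 4 = c -> x' %% 4 = a' -> y' %% 4 = c' -> b %% 4 = d ->
  (a' + d + a).+1 %% 4 == (c + c') %% 4 ->
  x < y -> y <= x' -> x' < y' -> y' <= b -> False.
Proof.
move=> h h' <- <- <- <- <- /eqP r h1 h2 h3 h4; apply: (disjoint_mod4 h h' h1 h2 h3 h4).
by rewrite -succ_add3_mod4 r modnDm.
Qed.

(* The residues of the chord ends are found among the hypotheses, so each clash is
   refuted by evaluating a closed congruence. *)
Ltac kcross h h' := eapply (crossing_contra h h'); [eassumption|eassumption|eassumption|eassumption|eassumption|reflexivity|olia|olia|olia|olia].
Ltac knest h h' := eapply (nested_contra h h'); [eassumption|eassumption|eassumption|eassumption|reflexivity|olia|olia|olia|olia|olia].
Ltac kside h h' := eapply (disjoint_contra h h'); [eassumption|eassumption|eassumption|eassumption|eassumption|reflexivity|olia|olia|olia|olia].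
Ltac kchord h := exfalso; eapply (chord_contra h); [eassumption|eassumption|eassumption|reflexivity|olia|olia|olia].
Ltac kpair h h' := exfalso; first [kcross h h'|kcross h' h|knest h h'|knest h' h|kside h h'|kside h' h].
Ltac k2 h hs f := first [kpair h f|kpair hs f].
Ltac k1 h hs := first [kchord h|kchord hs].
Ltac neqm x y := try (assert (x <> y) by (intro; congruence)).
Ltac flip h := let hs := fresh "s" h in move: (h); rewrite Esym => hs.

(** The chords agree in the sum and in the difference of their ends modulo 4. Equal sums forbid a
    crossing and equal differences a nesting. Disjoint chords are excluded because, for [b] equal to
    3 modulo 4, the ends of a chord have the same parity. *)
Lemma even_class x y x' y' : b %% 4 = 3 -> E x y -> E x' y' -> x < y -> x' < y' -> y <= b -> y' <= b ->
  x.+1 < y -> 0 < x \/ y < b ->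
  (x + y) %% 4 = (x' + y') %% 4 -> (x + y') %% 4 = (x' + y) %% 4 -> x = x' /\ y = y'.
Proof.
move=> b3 h h' l l' yb yb' lx ln r1 r2.
have [c1 /(_ ln) c2] := @chord_mod4 x y h ltac:(elia).
have [[h1 h2]|ne] : x = x' /\ y = y' \/ (x <> x' \/ y <> y') by elia.
  by [].
exfalso.
have [o|[o|[o|[o|[o|o]]]]] : (x < x' /\ x' < y /\ y < y') \/ (x' < x /\ x < y' /\ y' < y) \/ (x <= x' /\ y' <= y) \/ (x' <= x /\ y <= y') \/ y <= x' \/ y' <= x by clear - l l'; lia.
- by have [] := @crossing_mod4 x y x' y' h h' ltac:(elia) ltac:(elia) ltac:(elia) yb'; rewrite r1.
- by have [] := @crossing_mod4 x' y' x y h' h ltac:(elia) ltac:(elia) ltac:(elia) yb; rewrite r1.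
- by apply: (@nested_mod4 x y x' y') => //; elia.
- by apply: (@nested_mod4 x' y' x y) => //; elia.
- apply: (@disjoint_mod4 x y x' y' h h' l o l' yb').
  clear - b3 r1 r2 c1 c2; lia.
- apply: (@disjoint_mod4 x' y' x y h' h l' o l yb).
  clear - b3 r1 r2 c1 c2; lia.
Qed.

(* With k fixed the residues determine that of j, and nested chords from 0 have
   end points in different residue classes; hence 0 has a single chord besides
   its edges to 1 and b.  By symmetry the same holds for w. *)
Lemma end_chord_residues j k : E 0 j -> E w k -> 2 <= j < w -> 1 <= k -> k.+2 <= w ->
  (b %% 4 = 3 /\ (j %% 4 = 0 /\ k %% 4 = 0 \/ j %% 4 = 2 /\ k %% 4 = 2)) \/
  (b %% 4 = 0 /\ (j %% 4 = 2 /\ k %% 4 = 1 \/ j %% 4 = 3 /\ k %% 4 = 0)) \/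
  (b %% 4 = 2 /\ (j %% 4 = 0 /\ k %% 4 = 1 \/ j %% 4 = 3 /\ k %% 4 = 2)).
Proof.
move=> e; rewrite Esym => f hj hk1 hk2.
have c0 := cycle_mod.
have R0 : 0 %% 4 = 0 by [].
have [Rb|[Rb|[Rb|Rb]]] := mod4_cases b; [have Rw : w %% 4 = 3 by elia| by elia | have Rw : w %% 4 = 1 by elia | have Rw : w %% 4 = 2 by elia];
have [Rj|[Rj|[Rj|Rj]]] := mod4_cases j; try kchord e;
have [Rk|[Rk|[Rk|Rk]]] := mod4_cases k; try kchord f;
(have [o|o] := leqP j k; try kpair e f; clear - Rb Rj Rk; rewrite ?Rb ?Rj ?Rk; lia).
Qed.

Definition nbrs_among t x y z := forall c, c <= b -> E t c -> c = x \/ c = y \/ c = z.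

(** The run of indices from [p'] to [q'] serves as the path joining the third neighbours. Since [p]
    and [q] are ends of Hamiltonian paths, the lists of their neighbours on the cycle are complete
    in the whole graph. *)
Definition twins := exists p q x y p' q',
  [/\ [/\ T p, T q, p <> q & x <> y],
      [/\ p <= b, q <= b, x <= b, y <= b & maxn p' q' <= w],
      [/\ E p x, E p y & E p p'] /\ [/\ E q x, E q y & E q q'],
      nbrs_among p x y p' /\ nbrs_among q x y q' &
      forall i, minn p' q' <= i <= maxn p' q' -> [/\ i <> p, i <> q, i <> x & i <> y]].

Definition small_cycle := b = 4 /\ [/\ T 0, T 1, T 2 & T 3].

Lemma hampath_end_0 : T 0.
Proof. by ends 0 b (@nil (nat*nat)). Qed.

Lemma hampath_end_w : T w.
Proof. by ends w 0 [:: (b, b)]. Qed.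

(** * Rotations of the Hamiltonian path along a chord from [0] *)

Section Outer.
Variables j u : nat.
Hypothesis e : E 0 j.
Hypothesis ju : j = u.+1.
Hypothesis hj : 2 <= j < w.
Let R0 : 0 %% 4 = 0 := erefl.

(** This and the next two lemmas are rotations: a chord at the current first vertex makes another
    vertex the first one, while the path still ends in [b]. *)
Lemma hampath_end_u : T u.
Proof. by ends u 0 [:: (j, b)]. Qed.

Lemma hampath_end_forward c : E u c -> j < c < b -> T c.-1.
Proof. by move=> h o; ends c.-1 j [:: (0, u); (c, b)]. Qed.

Lemma hampath_end_backward c : E u c -> c.+2 <= u -> T c.+1.
Proof. by move=> h o; ends c.+1 u [:: (c, 0); (j, b)]. Qed.

Variable c : nat.
Hypothesis g : E u c.
Hypothesis Rc : c %% 4 = 3.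
Hypothesis jc : j < c < w.
Hypothesis H0 : forall z, z <= b -> E 0 z -> [\/ z = 1, z = j, z = b | z = w].
Hypothesis K : forall y, 0 < y < j -> E y c.-1 -> y %% 4 = 3 -> False.

(** The end [c.-1] has a neighbour besides its two neighbours on the cycle. Unless [c.-1] is [j],
    every position and residue of that neighbour is excluded. *)
Lemma outer_near : b %% 4 = 0 /\ j %% 4 = 2 \/ b %% 4 = 2 /\ j %% 4 = 0 -> c = j.+1 /\ b %% 4 = 0.
Proof.
move=> Rbj.
have ht := hampath_end_forward g ltac:(elia).
move et : c.-1 ht => t ht; have ct : c = t.+1 by elia.
have Rt : t %% 4 = 2 by elia.
have [tj|tj] : t = j \/ t <> j by elia.
  by split=> //; elia.
exfalso; have [y [yb h y1 y2]] := end_deg3 ht t.-1 c.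
flip h; have ty := E_neq h; flip g.
have y0 : y <> 0.
  by move=> y0; rewrite y0 in sh; have [||||] := H0 _ sh; elia.
have K' : y < j -> y %% 4 = 3 -> False.
  by move=> yj; apply: (@K y); [elia|rewrite et].
case: Rbj => -[Rb Rj]; [have Ru : u %% 4 = 1 by clear - Rj ju; lia | have Ru : u %% 4 = 3 by clear - Rj ju; lia].
all: have [Ry|[Ry|[Ry|Ry]]] := mod4_cases y; have [o|o] := ltnP y t;
  first [k1 h sh|k2 h sh e|k2 h sh g| neqm y j; have [o3|o3] := ltnP y j; first [by case: (K' _ Ry); elia|k2 h sh e|k2 h sh g|idtac]].
(* Pairs of chords do not settle what remains; a cycle through the three chords [u c], [0 j] and
   [t y] and the edge [0 b] does. *)
all: cyc t c [:: (u, j); (0, 0); (b, y)]; clear - cy o y2 Ry Rb ct yb ju; elia.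
Qed.

Hypothesis cj : c = j.+1.
Hypothesis Rb : b %% 4 = 0.
Hypothesis n_jb : ~ E j b.
Hypothesis d_j : deg4 j.
Hypothesis d_c : E j j.+2 -> deg4 c.

(** One more rotation: a fourth neighbour [y] of [j] must lie beyond [c], so [y.-1] becomes an end,
    and any further neighbour of that end closes a forbidden cycle. *)
Lemma outer_adjacent : False.
Proof.
have Rj : j %% 4 = 2 by clear - Rc cj; elia.
have Ru : u %% 4 = 1 by clear - Rj ju; elia.
have gs := g; rewrite Esym in gs.
have [y [yb h y1 y2 y3]] := d_j u c 0.
have [yc Ry] : c < y /\ y %% 4 = 0.
{ flip h; have jy := E_neq h.
  have K' : y < j -> y %% 4 = 3 -> False.
    by move=> yj; apply: (@K y); [elia|rewrite cj].
  have [Ry|[Ry|[Ry|Ry]]] := mod4_cases y; have [o|o] := ltnP y j;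
    first [by split; [olia|exact: Ry]|exfalso; by case: (K' _ Ry); olia|k1 h sh|k2 h sh e]. }
have yb' : y <> b by move=> yb'; apply: n_jb; rewrite -yb'.
have yw : y < w by clear - yb' yb Ry Rb bw; elia.
move et : y.-1 => t; have ty : y = t.+1 by olia.
have ht : T t by ends t c [:: (u, 0); (j, j); (y, b)].
have Rt : t %% 4 = 3 by clear - ty Ry; elia.
(* If [t] is [c], then [u] is already one of its neighbours and [y] is [j.+2], so degree 4 at [c] is
   needed; otherwise degree 3 suffices. *)
have [z [zb h' z1 z2 z3]] : exists z, [/\ z <= b, E t z, z <> t.-1, z <> y & t <> c \/ z <> u].
  have [tc|tc] : t = c \/ t <> c by olia.
    have [|z [zb h' z1 z2 z3]] := @d_c _ j y u; first by rewrite -cj -tc -ty.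
    by exists z; split; rewrite ?tc //; [olia|right].
  by have [z [zb h' z1 z2]] := end_deg3 ht t.-1 y; exists z; split=> //; left.
flip h'; have tz := E_neq h'.
have z0 : z <> 0.
  by move=> z0; rewrite z0 in sh'; have [||||] := H0 _ sh'; olia.
have tj : j < t by olia.
have [Rz|[Rz|[Rz|Rz]]] := mod4_cases z; have [o|o] := ltnP z t;
  first [k1 h' sh'|k2 h' sh' e|k2 h' sh' g|k2 h' sh' h|
    neqm z j; neqm z b; have [o3|o3] := ltnP z j; first [k2 h' sh' e|k2 h' sh' g|k2 h' sh' h|idtac]].
cyc j j [:: (y, z); (t, c); (u, 0)]; clear - cy o z2 Rz Rj cj ty ju yc tz; elia.
Qed.

End Outer.

(** * Chords from [0] and [w] when these two are not adjacent *)

Section Nonadjacent.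
Variables j k u : nat.
Hypothesis e : E 0 j.
Hypothesis f : E k w.
Hypothesis ju : j = u.+1.
Hypothesis hj : 2 <= j < w.
Hypothesis hk : 1 <= k.
Hypothesis hkw : k.+2 <= w.
Hypothesis n0w : ~~ E 0 w.
Let R0 : 0 %% 4 = 0 := erefl.

Let Tu := hampath_end_u e ju hj.
Let Tfwd := hampath_end_forward e ju hj.
Let Tbwd := hampath_end_backward e ju hj.

Lemma end_chord_residues' : (b %% 4 = 3 /\ (j %% 4 = 0 /\ k %% 4 = 0 \/ j %% 4 = 2 /\ k %% 4 = 2)) \/
  (b %% 4 = 0 /\ (j %% 4 = 2 /\ k %% 4 = 1 \/ j %% 4 = 3 /\ k %% 4 = 0)) \/
  (b %% 4 = 2 /\ (j %% 4 = 0 /\ k %% 4 = 1 \/ j %% 4 = 3 /\ k %% 4 = 2)).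
Proof. by apply: (end_chord_residues e _ hj hk hkw); rewrite Esym. Qed.

Lemma nbrs_0 : nbrs_among 0 1 j b.
Proof.
move=> c cb h.
have cw : c <> w by move=> ec; move: n0w; rewrite -ec h.
have cn := E_neq h.
have [->|[->|hc]] : c = 1 \/ c = b \/ 2 <= c < w by elia.
- by left.
- by right; right.
right; left; have fs := f; rewrite Esym in fs.
have t1 := end_chord_residues h fs hc hk hkw; have t2 := end_chord_residues'.
have Rc : c %% 4 = j %% 4 by clear - t1 t2; lia.
clear t1 t2; have [o|[//|o]] : c < j \/ c = j \/ j < c by elia.
- by case: (@nested_mod4 0 j 0 c e h); rewrite ?add0n ?Rc //; elia.
- by case: (@nested_mod4 0 c 0 j h e); rewrite ?add0n ?Rc //; elia.
Qed.

Lemma nbrs_w : nbrs_among w k w.-1 b.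
Proof.
move=> c cb h.
have c0' : c <> 0 by move=> ec; move: n0w; rewrite Esym -ec h.
have cn := E_neq h.
have [->|[->|[hc1 hc2]]] : c = w.-1 \/ c = b \/ 1 <= c /\ c.+2 <= w by elia.
- by right; left.
- by right; right.
left.
have t1 := end_chord_residues e h hj hc1 hc2; have t2 := end_chord_residues'.
have Rc : c %% 4 = k %% 4 by clear - t1 t2; lia.
clear t1 t2; have hs := h; rewrite Esym in hs.
have [o|[//|o]] : c < k \/ c = k \/ k < c by elia.
- by case: (@nested_mod4 c w k w hs f); rewrite -1?(modnDml k) -1?(modnDml c) ?Rc //; elia.
- by case: (@nested_mod4 k w c w f hs); rewrite -1?(modnDml k) -1?(modnDml c) ?Rc //; elia.
Qed.

(** The twins [0] and [u] share [b] and [j], and the run from [1] to [u.-1] joins their third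
    neighbours. For [j = 2] the vertex [u] would itself be the neighbour [1] of [0]. *)
Lemma twins_0u : 3 <= j -> E u b -> nbrs_among u u.-1 j b -> twins.
Proof.
move=> j3 h n; exists 0, u, b, j, 1, u.-1; split.
- by split; [apply: hampath_end_0|apply: Tu|lia|lia].
- by split; elia.
- split; split; adj.
- by split=> c cb h'; [have := nbrs_0 cb h'|have := n c cb h']; lia.
- by move=> i; split; elia.
Qed.

(** By [nbrs_0] the end [0] has no fourth neighbour, so of two adjacent ends it must be [t] that has
    one. *)
Lemma deg4_nbr_0 t : T t -> E 0 t -> deg4 t.
Proof.
move=> h h'; case: (end_adj_deg4 hampath_end_0 h h') => // d.
by have [c [cb h1 ? ? ?]] := d 1 j b; have := nbrs_0 cb h1; lia.
Qed.

Lemma deg4_nbr_w t : T t -> E w t -> deg4 t.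
Proof.
move=> h h'; case: (end_adj_deg4 hampath_end_w h h') => // d.
by have [c [cb h1 ? ? ?]] := d k w.-1 b; have := nbrs_w cb h1; lia.
Qed.

(** A neighbour of the end [u] other than [u.-1], [j] and [b] gives a chord that is forbidden by
    itself or clashes with [0 j] or [k w]. Degree 3 then forces the edge [u b]. *)
Lemma twins_inner : b %% 2 = 0 -> j %% 4 = 3 -> twins.
Proof.
move=> Rb Rj.
have Ru : u %% 4 = 2 by elia.
have F0 := end_chord_residues'.
have Rk : k %% 4 = b %% 4 by clear - F0 Rb Rj; lia.
have n : nbrs_among u u.-1 j b.
  move=> c cb h; flip h; have cu := E_neq h.
  have [->|[->|[->|/= co]]] : c = u.-1 \/ c = j \/ c = b \/ [&& c != u.-1, c != j & c != b] by elia.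
  1-3: by auto.
  exfalso; clear F0.
  have [Rb'|Rb'] : b %% 4 = 0 \/ b %% 4 = 2 by clear - Rb; lia.
  - rewrite Rb' in Rk; have Rw : w %% 4 = 3 by clear - Rb' bw; lia.
    have kj : j <= k by have [//|o] := leqP j k; kpair e f.
    have [Rc|[Rc|[Rc|Rc]]] := mod4_cases c; have [o|o] := ltnP c u; first [k1 h sh|k2 h sh e|k2 h sh f|idtac].
    by neqm c w; have [o2|o2] := leqP c k; k2 h sh f.
  - rewrite Rb' in Rk; have Rw : w %% 4 = 1 by clear - Rb' bw; lia.
    have kj : j <= k by have [//|o] := leqP j k; kpair e f.
    have [Rc|[Rc|[Rc|Rc]]] := mod4_cases c; have [o|o] := ltnP c u; first [k1 h sh|k2 h sh e|k2 h sh f|idtac].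
    by neqm c w; have [o2|o2] := leqP c k; k2 h sh f.
have [c [cb h c1 c2]] := end_deg3 Tu u.-1 j.
have cb' : c = b by have := n c cb h; clear - c1 c2; lia.
by rewrite cb' in h; apply: twins_0u => //; clear - Rj; lia.
Qed.

(** By [even_class] every chord at [t] is [0 j] or [k w]. Either one makes [t] a neighbour of [0] or
    [w], hence of degree at least 4, so both chords would have to end in [t], that is
    [t = j = k]. *)
Lemma no_end_2mod4 t : b %% 4 = 3 -> T t -> t %% 4 = 2 -> 0 < t < w -> ~ (t = j /\ t = k) -> False.
Proof.
move=> Rb ht Rt t0 tjk.
have F0 : (j %% 4 = 0 /\ k %% 4 = 0 \/ j %% 4 = 2 /\ k %% 4 = 2) by have := end_chord_residues'; clear - Rb; lia.
suff D y : y <= b -> E t y -> y <> t.-1 -> y <> t.+1 -> (t = j /\ y = 0) \/ (t = k /\ y = w).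
  have [y [yb h y1 y2]] := end_deg3 ht t.-1 t.+1.
  case: (D y yb h y1 y2) => -[tj y0].
    have h0 : E 0 t by rewrite tj.
    have [z [zb h' z1 z2 z3]] := deg4_nbr_0 ht h0 t.-1 t.+1 0.
    by have := D z zb h' z1 z2; clear - tj tjk z3; lia.
  have hw : E w t by rewrite tj Esym.
  have [z [zb h' z1 z2 z3]] := deg4_nbr_w ht hw t.-1 t.+1 w.
  by have := D z zb h' z1 z2; clear - tj tjk z3; lia.
move=> yb h y1 y2; have yt := E_neq h; flip h.
have Rw : w %% 4 = 2 by elia.
have Ry : y %% 4 = 0 \/ y %% 4 = 2
  by have [Ry|[Ry|[Ry|Ry]]] := mod4_cases y; [by left| |by right|]; exfalso;
    have [o|o] := leqP y t; k1 h sh.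
have {}D x z : E x z -> x < z -> z <= b -> x.+1 < z -> 0 < x \/ z < b ->
  (x = t /\ z = y) \/ (x = y /\ z = t) -> (x = 0 /\ z = j) \/ (x = k /\ z = w).
  move=> hx l1 l2 l3 l4 l5.
  have [[r1 r2]|[r1 r2]] : ((x + z) %% 4 = (0 + j) %% 4 /\ (x + j) %% 4 = (0 + z) %% 4) \/
      ((x + z) %% 4 = (k + w) %% 4 /\ (x + w) %% 4 = (k + z) %% 4).
  - case: l5 => -[-> ->]; clear - F0 Ry Rt Rw; lia.
  - by left; apply: (even_class Rb hx e) => //; olia.
  - by right; apply: (even_class Rb hx f) => //; olia.
have [o|o] : t < y \/ y < t by elia.
- by have := D t y h; olia.
- by have := D y t sh; olia.
Qed.

(** A neighbour [c] of [u] other than [u.-1], [j] and [b] either clashes with a known chord or,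
    after a rotation, makes [c.+1] or [c.-1] an end that is 2 modulo 4. *)
Lemma twins_even_cycle : b %% 4 = 3 -> twins.
Proof.
move=> Rb.
have F0 : (j %% 4 = 0 /\ k %% 4 = 0 \/ j %% 4 = 2 /\ k %% 4 = 2) by have := end_chord_residues'; clear - Rb; lia.
have Rw : w %% 4 = 2 by elia.
have n : nbrs_among u u.-1 j b.
{ move=> c cb h; flip h; have cu := E_neq h.
  have [->|[->|[->|/= co]]] : c = u.-1 \/ c = j \/ c = b \/ [&& c != u.-1, c != j & c != b] by olia.
  1-3: by auto.
  exfalso.
  have [[Rj Rk]|[Rj Rk]] := F0; [have Ru : u %% 4 = 3 by elia|have Ru : u %% 4 = 1 by elia]; clear F0.
  all: have [Rc|[Rc|[Rc|Rc]]] := mod4_cases c; have [o|o] := ltnP c u; first [k1 h sh|k2 h sh e|k2 h sh f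
    |neqm c k; neqm u k; neqm c w; have [o2|o2] := ltnP k c; have [o3|o3] := ltnP k u;
     first [k2 h sh f | by apply: (@no_end_2mod4 c.+1 Rb (Tbwd h _)); elia
           | by apply: (@no_end_2mod4 c.-1 Rb (Tfwd h _)); elia]]. }
have [c [cb h c1 c2]] := end_deg3 Tu u.-1 j.
have cb' : c = b by have := n c cb h; clear - c1 c2; lia.
rewrite cb' in h; have [j3|j3] := leqP 3 j; first exact: twins_0u.
(* For [j = 2] the vertex [u] is [1]; being adjacent to [0] it would need a fourth neighbour. *)
have E0u : E 0 u by adj.
have [z [zb h' z1 z2 z3]] := deg4_nbr_0 Tu E0u u.-1 j b.
by have := n z zb h'; clear - z1 z2 z3; lia.
Qed.

(** Rotation along [u c] makes [c.-1] an end, and no residue is left for a further neighbour of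
    it. *)
Lemma outer_far c : b %% 2 = 0 -> k %% 4 = 1 -> E u c -> c %% 4 = b %% 4 -> j < c < w -> k < c -> False.
Proof.
move=> Rb Rk g Rc jc kc.
have F0 := end_chord_residues'.
have [Rb' Rj] : (b %% 4 = 0 \/ b %% 4 = 2) /\ j %% 4 = (b + 2) %% 4 by clear - F0 Rb Rk; lia.
clear F0.
have ht := Tfwd g ltac:(elia).
move et : c.-1 ht => t ht; have ct : c = t.+1 by elia.
(* When [c.-1] is [k], its neighbour [w] is already known; degree at least 4, due to the adjacency
   with [w], supplies another one. *)
have [y [yb h y1 y2 y3]] : exists y, [/\ y <= b, E t y, y <> t.-1, y <> c & t <> k \/ y <> w].
  have [tk|tk] : t = k \/ t <> k by elia.
    have [|y [yb h y1 y2 y3]] := deg4_nbr_w ht _ t.-1 c w; first by rewrite tk Esym.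
    by exists y; split=> //; right.
  by have [y [yb h y1 y2]] := end_deg3 ht t.-1 c; exists y; split=> //; left.
have jt : j < t by elia.
flip h; have ty := E_neq h; flip g.
have y0 : y <> 0.
  by move=> y0; rewrite y0 in sh; have [||] := nbrs_0 _ sh; elia.
case: Rb' => Rb'; [have Rw : w %% 4 = 3 by clear - Rb' bw; lia | have Rw : w %% 4 = 1 by clear - Rb' bw; lia];
 [have Ru : u %% 4 = 1 by clear - Rj Rb' ju; lia | have Ru : u %% 4 = 3 by clear - Rj Rb' ju; lia];
 [have Rt : t %% 4 = 3 by clear - Rc Rb' ct; lia | have Rt : t %% 4 = 1 by clear - Rc Rb' ct; lia];
 [have Rj' : j %% 4 = 2 by clear - Rj Rb'; lia | have Rj' : j %% 4 = 0 by clear - Rj Rb'; lia];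
 rewrite Rb' in Rc; clear Rj Rb.
all: have [Ry|[Ry|[Ry|Ry]]] := mod4_cases y; have [o|o] := ltnP y t;
  first [k1 h sh|k2 h sh e|k2 h sh f|k2 h sh g|
   neqm y w; neqm y b; neqm y k; neqm y j; have [o2|o2] := leqP y k; have [o3|o3] := ltnP y u; first [k2 h sh e|k2 h sh f|k2 h sh g|idtac]].
all: have [yk|[[yk1 yk2]|yk]] : k = t \/ (k < t /\ y < k) \/ y = k by elia.
all: first [k2 h sh f | rewrite yk in sh; k2 h sh f | exfalso; congruence | idtac].
cyc k k [:: (w, b); (0, 0); (j, y)]; clear - cy Ry Rj' yk o o3 ju Rb' bw; elia.
Qed.

Lemma nbrs_0_weak z : z <= b -> E 0 z -> [\/ z = 1, z = j, z = b | z = w].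
Proof.
move=> zb h; case: (nbrs_0 zb h) => [->|[->|->]].
- exact: Or41.
- exact: Or42.
- exact: Or43.
Qed.

(** Pairs of chords and [outer_far] leave for [u], besides [u.-1], [j] and [b], only neighbours
    between [j] and [k]. Such a neighbour is [j.+1] by [outer_near], and [outer_adjacent] rules it
    out. *)
Lemma twins_outer_apart : b %% 2 = 0 -> k %% 4 = 1 -> j < k -> twins.
Proof.
move=> Rb Rk jk.
have Rbj : b %% 4 = 0 /\ j %% 4 = 2 \/ b %% 4 = 2 /\ j %% 4 = 0.
  by have := end_chord_residues'; clear - Rb Rk; lia.
have step c : c <= b -> E u c -> [\/ c = u.-1, c = j, c = b | c %% 4 = 3 /\ j < c < k].
{ move=> cb h; flip h; have cu := E_neq h.
  have [->|[->|[->|/= co]]] : c = u.-1 \/ c = j \/ c = b \/ [&& c != u.-1, c != j & c != b] by olia.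
  1: by apply: Or41.
  1: by apply: Or42.
  1: by apply: Or43.
  have cw : c <> w.
    by move=> cw; rewrite cw in sh; have := @nbrs_w u ltac:(olia) sh; olia.
  case: Rbj => -[Rb' Rj]; [have Rw : w %% 4 = 3 by clear - Rb' bw; lia | have Rw : w %% 4 = 1 by clear - Rb' bw; lia];
   [have Ru : u %% 4 = 1 by clear - Rj ju; lia | have Ru : u %% 4 = 3 by clear - Rj ju; lia].
  all: have [Rc|[Rc|[Rc|Rc]]] := mod4_cases c; have [o|o] := ltnP c u; have [o2|o2] := ltnP c k; neqm c k;
   first [by apply: Or44; split; [exact: Rc|olia] | exfalso; first [k1 h sh|k2 h sh e|k2 h sh f
    | by apply: (outer_far Rb Rk h); rewrite ?Rc ?Rb' //; olia]]. }
have side3 c y : j < c < k -> c %% 4 = 3 -> 0 < y < j -> E y c.-1 -> y %% 4 = 3 -> False.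
{ move=> jck Rc yj h Ry; flip h; have Rt : c.-1 %% 4 = 2 by clear - Rc; lia.
  by case: Rbj => -[Rb' Rj]; [have Rw : w %% 4 = 3 by clear - Rb' bw; lia | have Rw : w %% 4 = 1 by clear - Rb' bw; lia];
    k2 h sh f. }
have near c : E u c -> c %% 4 = 3 -> j < c < k -> c = j.+1 /\ b %% 4 = 0.
{ move=> h Rc jck; apply: (@outer_near j u e ju hj c h Rc _ nbrs_0_weak _ Rbj); first by olia.
  by move=> y yj hy Ry; apply: (side3 c y jck Rc yj hy Ry). }
have dead c : E u c -> c %% 4 = 3 -> j < c < k -> False.
{ move=> h Rc jck; have [cj Rb4] := near c h Rc jck.
  have Rj : j %% 4 = 2 by clear - Rbj Rb4; lia.
  have Rw : w %% 4 = 3 by clear - Rb4 bw; lia.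
  apply: (@outer_adjacent j u e ju hj c h Rc _ nbrs_0_weak _ cj Rb4); first by olia.
  - by move=> y yj hy Ry; apply: (side3 c y jck Rc yj hy Ry).
  - by move=> h'; flip h'; k2 h' sh' f.
  - have tj : T j by have := Tfwd h ltac:(olia); rewrite cj.
    exact: deg4_nbr_0.
  move=> hy.
  have tc : T c by ends c c [:: (u, 0); (j, j); (j.+2, b)].
  case: (end_adj_deg4 Tu tc h) => // d.
  have [z [zb h' z1 z2 z3]] := d u.-1 j c.
  case: (step z zb h') => [//|//|zb'|[Rz jz]]; last first.
    by have [zj _] := near z h' Rz jz; case: z3; rewrite zj cj.
  rewrite zb' in h'.
  by cyc b b [:: (u, u); (c, j.+2); (j, j); (0, 0)]; move: cy; rewrite cj; case; olia. }
have n : nbrs_among u u.-1 j b.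
  move=> c cb h; case: (step c cb h) => [->|->|->|[Rc jc]]; [by left|by right; left|by right; right|].
  by case: (dead c h Rc jc).
have [c [cb h c1 c2]] := end_deg3 Tu u.-1 j.
have cb' : c = b by have := n c cb h; clear - c1 c2; lia.
rewrite cb' in h; have [j3|j3] := leqP 3 j; first exact: twins_0u.
have E0u : E 0 u by adj.
have [z [zb h' z1 z2 z3]] := deg4_nbr_0 Tu E0u u.-1 j b.
by have := n z zb h'; clear - z1 z2 z3; lia.
Qed.

(** Three successive rotations, along [0 j], [u c] and [c.+1 y]. *)
Lemma hampath_end_above c y : E c u -> c.+2 <= u -> E c.+1 y -> j < y <= b -> T y.-1.
Proof. by move=> g cu h yj; ends y.-1 j [:: (0, c); (u, c.+1); (y, b)]. Qed.

(** The twins are [u] and [c.+1], where [c] is the third neighbour of [u]. Rotation makes [c.+1] an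
    end, its neighbours turn out to be [c], [c.+2] and [j], and the run from [c.+2] to [u.-1] joins
    the third neighbours. *)
Lemma twins_outer_cross : b %% 2 = 0 -> k %% 4 = 1 -> k < u -> twins.
Proof.
move=> Rb Rk ku.
have Rbj : b %% 4 = 0 /\ j %% 4 = 2 \/ b %% 4 = 2 /\ j %% 4 = 0.
  by have := end_chord_residues'; clear - Rb Rk; lia.
have step c : c <= b -> E u c -> [\/ c = u.-1, c = j | [/\ c %% 4 = j %% 4, k < c & c.+2 <= u]].
{ move=> cb h; flip h; have cu := E_neq h.
  have [->|[->|/= co]] : c = u.-1 \/ c = j \/ [&& c != u.-1 & c != j] by olia.
  1: by apply: Or31.
  1: by apply: Or32.
  have cw : c <> w.
    by move=> cw; rewrite cw in sh; have := @nbrs_w u ltac:(olia) sh; olia.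
  case: Rbj => -[Rb' Rj]; [have Rw : w %% 4 = 3 by clear - Rb' bw; lia | have Rw : w %% 4 = 1 by clear - Rb' bw; lia];
   [have Ru : u %% 4 = 1 by clear - Rj ju; lia | have Ru : u %% 4 = 3 by clear - Rj ju; lia].
  all: have [Rc|[Rc|[Rc|Rc]]] := mod4_cases c; have [o|o] := ltnP c u; have [o2|o2] := ltnP c k; neqm c k; neqm c b;
   first [by apply: Or33; split; [rewrite Rc Rj|olia|olia] | exfalso; first [k1 h sh|k2 h sh e|k2 h sh f
    | (have [o3|o3] : c = b \/ c < w by olia); first [rewrite o3 in h sh Rc; k2 h sh f | 
      by apply: (outer_far Rb Rk h); rewrite ?Rc ?Rb' //; olia]]]. }
have [c [cb g c1 c2]] := end_deg3 Tu u.-1 j.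
have [Rc kc cu] : [/\ c %% 4 = j %% 4, k < c & c.+2 <= u] by case: (step c cb g).
(* Two candidates for [c] would be congruent, and then their chords to [u] are nested with forbidden
   residues. *)
have n_u : nbrs_among u j c u.-1.
{ move=> d db h; case: (step d db h) => [->|->|[Rd kd du]]; [by right; right|by left|].
  have [o|[->|o]] : c < d \/ d = c \/ d < c by olia.
  2: by right; left.
  all: exfalso; flip g; flip h; rewrite -Rd in Rc; have Ru := erefl (u %% 4).
  - by apply: (nested_mod4 sg sh); rewrite -1?(modnDml c) -1?(modnDml d) ?Rc; try olia.
  - by apply: (nested_mod4 sh sg); rewrite -1?(modnDml c) -1?(modnDml d) ?Rc; try olia. }
have ht := Tbwd g cu; move et : c.+1 ht => t ht; flip g.
have cu' : c.+3 <= u by clear - cu Rc Rbj ju; lia.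
have n_t : nbrs_among t j c c.+2.
{ move=> y yb h; have ty := E_neq h; flip h.
  have [->|[->|[->|/= co]]] : y = c \/ y = c.+2 \/ y = j \/ [&& y != c, y != c.+2 & y != j] by olia.
  1: by right; left.
  1: by right; right.
  1: by left.
  exfalso; case: Rbj => -[Rb' Rj]; [have Rw : w %% 4 = 3 by clear - Rb' bw; lia | have Rw : w %% 4 = 1 by clear - Rb' bw; lia];
   [have Ru : u %% 4 = 1 by clear - Rj ju; lia | have Ru : u %% 4 = 3 by clear - Rj ju; lia];
   [have Rt : t %% 4 = 3 by clear - Rj Rc et; lia | have Rt : t %% 4 = 1 by clear - Rj Rc et; lia]; rewrite Rj in Rc.
  all: have y0 : y <> 0 by (move=> y0; rewrite y0 in sh; have := @nbrs_0 t ltac:(olia) sh; olia).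
  all: have [Ry|[Ry|[Ry|Ry]]] := mod4_cases y; have [o|o] := ltnP y t; have [o2|o2] := leqP y k; have [o3|o3] := ltnP y j; neqm y b; neqm y u; neqm y w;
    first [k1 h sh|k2 h sh e|k2 h sh f|k2 h sh g|k2 h sh sg|idtac].
  (* A remaining neighbour [y] of [t] lies beyond [j] and makes [y.-1] an end, for which no third
     neighbour is possible. *)
  all: have yj : j + 4 <= y by clear - co o3 Ry Rj; elia.
  all: have hs : T y.-1 by (apply: (@hampath_end_above c y) => //; [rewrite et | clear - yj yb; lia]).
  all: move es : y.-1 hs => s hs; have ys : y = s.+1 by olia.
  all: have [z [zb h' z1 z2]] := end_deg3 hs s.-1 y; have sz := E_neq h'; flip h'.
  1: have Rs : s %% 4 = 1 by clear - ys Ry; lia.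
  2: have Rs : s %% 4 = 3 by clear - ys Ry; lia.
  all: have sb : s <= b by (clear - ys yb; lia).
  all: have z0 : z <> 0 by (move=> z0; rewrite z0 in sh'; have := nbrs_0 sb sh'; clear - hj yj ys yb; lia).
  all: have yw : y < w by (clear - H H1 yb bw; lia).
  all: clear H H0 H1 c1 c2 co ty y0 es et.
  all: have [Rz|[Rz|[Rz|Rz]]] := mod4_cases z; have [p|p] := ltnP z s; have [p2|p2] := leqP z k; have [p3|p3] := ltnP z j; neqm z b; neqm z w; neqm z k;
    first [k1 h' sh'|k2 h' sh' e|k2 h' sh' f|k2 h' sh' g|k2 h' sh' sg|k2 h' sh' h|idtac].
}
have [y [yb h y1 y2]] := end_deg3 ht c c.+2.
have yj : y = j by have := n_t y yb h; clear - y1 y2; lia.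
rewrite yj in h.
exists u, t, j, c, u.-1, c.+2; split.
- by split=> //; clear - et cu' ju cu; lia.
- by split; clear - et cu' ju hj bw; lia.
- split; split; adj.
- by [].
- by move=> i hi; split; clear - hi et cu' ju; lia.
Qed.

(** As neighbours of [w] and [0], the ends [u] and [j] have degree at least 4, which yields the
    edges [u b] and [j b]. In their presence the ends [w.-1] and [1] could not have a third
    neighbour unless [w = j.+1] and [u = 1]. *)
Lemma small_outer_touch : b %% 2 = 0 -> k %% 4 = 1 -> k = u -> small_cycle.
Proof.
move=> Rb Rk ku.
have [Rb' Rj] : b %% 4 = 0 /\ j %% 4 = 2 by have := end_chord_residues'; clear - Rb Rk ku ju; lia.
have Ru : u %% 4 = 1 by clear - Rj ju; lia.
have Rw : w %% 4 = 3 by clear - Rb' bw; lia.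
have fu : E u w by rewrite -ku.
have fs := fu; rewrite Esym in fs.
have gb : E u b.
{ have [c [cb h c1 c2 c3]] := deg4_nbr_w Tu fs u.-1 j w.
  have cu := E_neq h; flip h.
  have [cb'|cw] : c = b \/ c < w by clear - cb c3 bw; lia.
    by rewrite cb' in h.
  exfalso; have [Rc|[Rc|[Rc|Rc]]] := mod4_cases c; have [o|o] := ltnP c u;
    first [k1 h sh|k2 h sh e|k2 h sh f|k2 h sh fu
      |by apply: (outer_far Rb Rk h); rewrite ?Rc ?Rb' //; olia]. }
have Tj : T j by ends j w [:: (u, 0); (b, b)].
have jb : E j b.
{ have [c [cb h c1 c2 c3]] := deg4_nbr_0 Tj e u j.+1 0.
  have cu := E_neq h; flip h.
  have [cb'|cw] : c = b \/ c <= w by clear - cb bw; lia.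
    by rewrite cb' in h.
  exfalso; have [Rc|[Rc|[Rc|Rc]]] := mod4_cases c; have [o|o] := ltnP c j;
    first [k1 h sh|k2 h sh e|k2 h sh fu|k2 h sh gb]. }
have wj : w = j.+1.
{ have [//|wj] : w = j.+1 \/ j.+1 < w by clear - hj; lia.
  exfalso; have ht : T w.-1 by ends w.-1 j [:: (0, u); (w, b)].
  move et : w.-1 ht => t ht; have wt : w = t.+1 by olia.
  have [y [yb h y1 y2]] := end_deg3 ht t.-1 w; have ty := E_neq h; flip h.
  have [yb'|yw] : y = b \/ y < t by clear - yb y2 wt ty bw; lia.
    rewrite yb' in h.
    by cyc t t [:: (b, b); (0, 0); (j, u); (w, w)]; clear - cy ju; lia.
  have y0 : y <> 0 by (move=> y0; rewrite y0 in sh; have := @nbrs_0 t ltac:(olia) sh; clear - hj wt wj bw; lia).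
  have Rt : t %% 4 = 2 by clear - wt Rw; lia.
  have tj : j < t by clear - wj wt; lia.
  have [Ry|[Ry|[Ry|Ry]]] := mod4_cases y; have [o|o] := ltnP y j; neqm y u;
    first [k1 h sh|k2 h sh e|k2 h sh fu|k2 h sh gb|have [p|p] := ltnP y u; first [k2 h sh fu|k2 h sh gb]]. }
have u1 : u = 1.
{ have [//|u1] : u = 1 \/ 2 <= u by clear - hj ju; lia.
  have u5 : 4 < u by clear - u1 Ru; lia.
  exfalso; have ht : T 1 by ends 1 u [:: (w, j); (0, 0); (b, b)].
  have [y [yb h y1 y2]] := end_deg3 ht 0 2; have ty := E_neq h; flip h.
  have R1 : 1 %% 4 = 1 by [].
  have yw : y <> w by (move=> yw; rewrite yw in sh; have := @nbrs_w 1 ltac:(olia) sh; clear - u5 ku wj ju bw; lia).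
  have [yb'|[yj|[yj|yj]]] : y = b \/ y = j \/ y = u \/ y < u by clear - yb yw wj ju bw; lia.
  - rewrite yb' in h.
    by cyc 1 1 [:: (b, b); (w, w); (u, j); (0, 0)]; clear - cy ju; lia.
  - by rewrite yj in h sh; k1 h sh.
  - by rewrite yj in h sh; first [k1 h sh | k2 h sh gb | k2 h sh fu].
  have [Ry|[Ry|[Ry|Ry]]] := mod4_cases y; first [k1 h sh|k2 h sh e|k2 h sh fu|k2 h sh gb]. }
have b4 : b = 4 by clear - u1 ju wj bw; lia.
have [j2 w3] : j = 2 /\ w = 3 by clear - u1 ju wj; lia.
split=> //; split; [exact: hampath_end_0|by rewrite -u1|by rewrite -j2|by rewrite -w3; apply: hampath_end_w].
Qed.

End Nonadjacent.

Lemma nonadjacent_outcome : ~~ E 0 w -> twins \/ small_cycle.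
Proof.
move=> n0w.
have [j [jb e j1 j2]] := end_deg3 hampath_end_0 1 b.
have [k [kb f k1 k2]] := end_deg3 hampath_end_w w.-1 b.
have j0 := E_neq e; have kw := E_neq f.
have jw : j <> w by move=> jw; move: n0w; rewrite -jw e.
have k0 : k <> 0 by move=> k0; move: n0w; rewrite Esym -k0 f.
have hj : 2 <= j < w by olia.
have hk : 1 <= k by olia.
have hkw : k.+2 <= w by olia.
rewrite Esym in f.
have ju : j = j.-1.+1 by clear - hj; lia.
have fs := f; rewrite Esym in fs.
have F0 := end_chord_residues e fs hj hk hkw.
have [Rb|Rb] : b %% 4 = 3 \/ b %% 2 = 0 by clear - F0; lia.
  by left; apply: (@twins_even_cycle j k j.-1) => //.
have [Rj|[Rk Rj]] : j %% 4 = 3 \/ k %% 4 = 1 /\ j %% 2 = 0 by clear - F0 Rb; lia.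
  by left; apply: (@twins_inner j k j.-1) => //.
have [jk|[ku|ku]] : j < k \/ k < j.-1 \/ k = j.-1 by clear - Rk Rj; lia.
- by left; apply: (@twins_outer_apart j k j.-1) => //.
- by left; apply: (@twins_outer_cross j k j.-1) => //.
- by right; apply: (@small_outer_touch j k j.-1) => //.
Qed.

(** * The case where [0] and [w] are adjacent *)

Lemma hampath_end_1 : E 0 w -> T 1.
Proof. by move=> tau; ends 1 w [:: (0, 0); (b, b)]. Qed.

Lemma hampath_end_w1 : E 0 w -> T w.-1.
Proof. by move=> tau; ends w.-1 0 [:: (w, b)]. Qed.

Section Adjacent.
Variables j u : nat.
Hypothesis tau : E 0 w.
Hypothesis e : E 0 j.
Hypothesis ju : j = u.+1.
Hypothesis hj : 2 <= j < w.
Let R0 : 0 %% 4 = 0 := erefl.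
Let Tu := hampath_end_u e ju hj.
Let Tfwd := hampath_end_forward e ju hj.

(** A third neighbour [c] of [u] must lie beyond [j]; rotation makes [c.-1], which is 2 modulo 4, an
    end, and it has no room for a third neighbour. *)
Lemma adjacent_even : b %% 4 = 3 -> False.
Proof.
move=> Rb; have Rw : w %% 4 = 2 by clear - Rb bw; lia.
have Rj : j %% 4 = 0.
  by have [Rj|[Rj|[Rj|Rj]]] := mod4_cases j; [|exfalso..]; first [done|kchord e|kpair e tau].
have Ru : u %% 4 = 3 by clear - Rj ju; lia.
have [c [cb h c1 c2]] := end_deg3 Tu u.-1 j; have cu := E_neq h; flip h.
have [Rc jc] : c %% 4 = 3 /\ j < c < b.
{ have [Rc|[Rc|[Rc|Rc]]] := mod4_cases c; have [o|o] := ltnP c u; have [o2|o2] := ltnP c b;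
    first [by split; [|olia]|exfalso; first [k1 h sh|k2 h sh e|k2 h sh tau
       |have cb' : c = b by olia; rewrite cb' in h sh; k2 h sh tau]]. }
have ht := Tfwd h jc; move et : c.-1 ht => t ht.
have Rt : t %% 4 = 2 by clear - et Rc jc; lia.
have [y [yb h' y1 y2]] := end_deg3 ht t.-1 t.+1; have ty := E_neq h'; flip h'.
have jt : j < t < w by clear - et jc Rc Rj bw Rt; lia.
by have [Ry|[Ry|[Ry|Ry]]] := mod4_cases y; have [o|o] := ltnP y t; have [o2|o2] := leqP y j; neqm y b; neqm y j; neqm y 0;
    first [k1 h' sh'|k2 h' sh' e|k2 h' sh' tau].
Qed.

Section Far.
Hypothesis Rb : b %% 4 = 0.
Hypothesis Rj : j %% 4 = 2.
Let Ru : u %% 4 = 1. Proof. by clear - Rj ju; lia. Qed.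
Let Rw : w %% 4 = 3. Proof. by clear - Rb bw; lia. Qed.

Lemma adjacent_u c : c <= b -> E u c ->
  [\/ c = u.-1, c = j, c = b | [/\ c %% 4 = 3, j < c & c <= w]].
Proof.
move=> cb h; have cu := E_neq h; flip h.
have [->|[->|[->|/= co]]] : c = u.-1 \/ c = j \/ c = b \/ [&& c != u.-1, c != j & c != b] by olia.
1: by apply: Or41.
1: by apply: Or42.
1: by apply: Or43.
have [Rc|[Rc|[Rc|Rc]]] := mod4_cases c; have [o|o] := ltnP c u;
  first [by apply: Or44; split=> //; olia|exfalso; first [k1 h sh|k2 h sh e|k2 h sh tau]].
Qed.

Lemma adjacent_0 z : z <= b -> E 0 z -> [\/ z = 1, z = j, z = b | z = w].
Proof.
move=> zb h; have zn := E_neq h.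
have [->|[->|[->|[->|/= co]]]] : z = 1 \/ z = j \/ z = b \/ z = w \/ 2 <= z < w /\ z <> j by olia.
1: by apply: Or41.
1: by apply: Or42.
1: by apply: Or43.
1: by apply: Or44.
exfalso; have [Rz|[Rz|[Rz|Rz]]] := mod4_cases z; first [kchord h|kpair h tau|have [o|o] := ltnP z j; kpair h e].
Qed.

(** An edge [u w] would leave the end [1] without a third neighbour. Without it [u] and [w] are
    twins with common neighbours [b] and [j], and the run from [0] to [u.-1] joins their third
    neighbours. *)
Lemma adjacent_close : 4 < b -> w = j.+1 -> twins.
Proof.
move=> b5 wj; have u5 : 4 < u by clear - b5 wj ju bw Rb; lia.
have n_uw : ~ E u w.
{ move=> f; have fs := f; rewrite Esym in fs.
  have [y [yb h y1 y2]] := end_deg3 (hampath_end_1 tau) 0 2; have ty := E_neq h; flip h.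
  have R1 : 1 %% 4 = 1 by [].
  have [yb'|[yw|yj]] : y = b \/ y = w \/ y < w by clear - yb bw; lia.
  - rewrite yb' in h.
    by cyc 1 1 [:: (b, w); (u, j); (0, 0)]; clear - cy ju bw; lia.
  - by rewrite yw in h sh; k2 h sh f.
  have [Ry|[Ry|[Ry|Ry]]] := mod4_cases y; neqm y w; first [k1 h sh|k2 h sh tau|k2 h sh e]. }
have n : nbrs_among u b j u.-1.
{ move=> c cb h; case: (adjacent_u cb h) => [->|->|->|[Rc jc cw]]; [by right; right|by right; left|by left|].
  by case: n_uw; have <- : c = w by clear - jc cw wj; lia. }
have [c [cb h c1 c2]] := end_deg3 Tu u.-1 j.
have cb' : c = b by have := n c cb h; clear - c1 c2; lia.
rewrite cb' in h.
have nw : nbrs_among w b j 0.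
{ move=> k kb g; have wk := E_neq g; flip g.
  have [->|[->|[->|/= co]]] : k = b \/ k = j \/ k = 0 \/ (0 < k < u \/ k = u) by olia.
  1: by left.
  1: by right; left.
  1: by right; right.
  exfalso; case: co => co; last by apply: n_uw; rewrite -co Esym.
  have [Rk|[Rk|[Rk|Rk]]] := mod4_cases k; first [k1 g sg|k2 g sg tau|k2 g sg h]. }
exists u, w, b, j, u.-1, 0; split.
- by split=> //; [exact: hampath_end_w|clear - ju wj; lia|clear - hj bw; lia].
- by split; clear - hj bw ju; lia.
- split; split; adj.
- by [].
- by move=> i hi; split; clear - hi ju wj u5 bw; lia.
Qed.

(** The end [w.-1] is forced to be adjacent to [b], and this edge excludes both [u b] and [u w].
    Only [u.-1], [j] and [j.+1] remain for [u], so ends adjacent to [u] have degree at least 4, as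
    [outer_adjacent] requires. *)
Lemma adjacent_far : j.+1 < w -> False.
Proof.
move=> jw.
have hb : E w.-1 b.
{ have ht := hampath_end_w1 tau; move et : w.-1 ht => t ht; have wt : w = t.+1 by clear - et jw; lia.
  have [y [yb h y1 y2]] := end_deg3 ht t.-1 w; have ty := E_neq h; flip h.
  have [yb'|yw] : y = b \/ y < t by clear - yb y2 wt ty bw; lia.
    by rewrite yb' in h.
  exfalso; have Rt : t %% 4 = 2 by clear - wt Rw; lia.
  have tj : j < t by clear - wt jw; lia.
  have [Ry|[Ry|[Ry|Ry]]] := mod4_cases y; have [o|o] := ltnP y j; neqm y j;
    first [k1 h sh|k2 h sh tau|k2 h sh e|idtac].
  - have [y0|y0] : y = 0 \/ 0 < y by clear; lia.
      by rewrite y0 in h sh; k2 h sh e.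
    by k2 h sh e.
  cyc 0 0 [:: (j, y); (t, w)].
  have e1 : maxn j y - minn j y = y - j by clear - o; lia.
  have e2 : maxn t w - minn t w = 1 by clear - wt; lia.
  by apply: cy; rewrite e1 e2; clear - Rj Ry o; lia. }
have hbs := hb; rewrite Esym in hbs.
have n_ub : ~ E u b.
  by move=> h; cyc b b [:: (u, j); (0, 0); (w, w.-1)]; clear - cy ju jw hj bw; lia.
have n_uw : ~ E u w.
  by move=> h; cyc w w [:: (u, j); (0, 0); (b, b); (w.-1, w.-1)]; clear - cy ju jw hj bw; lia.
have K c y : j < c < w -> c %% 4 = 3 -> 0 < y < j -> E y c.-1 -> y %% 4 = 3 -> False.
{ move=> jc Rc yj h Ry; flip h; have Rt : c.-1 %% 4 = 2 by clear - Rc; lia.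
  by k2 h sh tau. }
have n c : c <= b -> E u c -> [\/ c = u.-1, c = j | c = j.+1].
{ move=> cb h; case: (adjacent_u cb h) => [->|->|cb'|[Rc jc cw]].
  - exact: Or31.
  - exact: Or32.
  - by case: n_ub; rewrite -cb'.
  have jcw : j < c < w.
    rewrite jc ltn_neqAle cw andbT; apply/eqP => cw'; apply: n_uw; by rewrite -cw'.
  apply: Or33; apply: (proj1 (@outer_near j u e ju hj c h Rc jcw adjacent_0 _ _)); last by left.
  by move=> y yj hy Ry; apply: (K c y). }
have [c [cb g c1 c2]] := end_deg3 Tu u.-1 j.
have cj : c = j.+1 by case: (n c cb g).
have Rc : c %% 4 = 3 by clear - cj Rj; lia.
have jc : j < c < w by clear - cj jw; lia.
have Tj : T j by have := Tfwd g ltac:(olia); rewrite cj.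
have d3 t : T t -> E u t -> deg4 t.
  move=> ht h; case: (end_adj_deg4 Tu ht h) => // d.
  by have [z [zb h' z1 z2 z3]] := d u.-1 j c; case: (n z zb h') => // zj; case: z3; rewrite zj cj.
apply: (@outer_adjacent j u e ju hj c g Rc jc adjacent_0 _ cj Rb).
- by move=> y yj hy Ry; apply: (K c y).
- move=> h; have Rw1 : w.-1 %% 4 = 2 by clear - Rw; lia.
  by kpair h hb.
- by apply: d3 => //; adj.
by move=> hy; apply: d3 => //; ends c c [:: (u, 0); (j, j); (j.+2, b)].
Qed.

End Far.

End Adjacent.

Lemma adjacent_outcome : E 0 w -> deg4 0 -> twins \/ small_cycle.
Proof.
move=> tau d.
have [j [jb e j1 j2 j3]] := d 1 w b; have j0 := E_neq e.
have hj : 2 <= j < w by clear - jb j1 j2 j3 j0 bw; lia.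
have ju : j = j.-1.+1 by clear - hj; lia.
have R0 : 0 %% 4 = 0 by [].
have c0 := cycle_mod.
have [Rb|[Rb|[Rb|Rb]]] := mod4_cases b.
- have Rw : w %% 4 = 3 by clear - Rb bw; lia.
  have Rj : j %% 4 = 2.
    by have [Rj|[Rj|[Rj|Rj]]] := mod4_cases j; first [done|exfalso; first [kchord e|kpair e tau]].
  have [b4|b4] : b = 4 \/ 4 < b by clear - Rb hj bw; lia.
    right; split=> //; have [w3 j2'] : w = 3 /\ j = 2 by clear - b4 bw hj Rj; lia.
    split; [exact: hampath_end_0|exact: (hampath_end_1 tau)|have -> : 2 = w.-1 by rewrite w3|rewrite -w3; exact: hampath_end_w].
    exact: (hampath_end_w1 tau).
  have [wj|wj] : w = j.+1 \/ j.+1 < w by clear - hj; lia.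
    by left; apply: (@adjacent_close j j.-1).
  by case: (@adjacent_far j j.-1).
- by case: c0; clear - Rb; lia.
- have Rw : w %% 4 = 1 by clear - Rb bw; lia.
  by kchord tau.
- by case: (@adjacent_even j j.-1).
Qed.

End Lollipop.

(** Classical, since [P] need not be decidable; the induction is on the distance to the bound. *)
Lemma ex_max (P : nat -> Prop) n0 m : P n0 -> (forall n, P n -> n <= m) ->
  exists n, P n /\ forall n', P n' -> n' <= n.
Proof.
move=> p0 ub; move: {2}(m - n0) (leqnn (m - n0)) => d.
elim: d n0 p0 => [|d IH] n0 p0 h.
  by exists n0; split=> // n' /ub; have := ub _ p0; lia.
have [[n1 [p1 h1]]|no] := classic (exists n1, P n1 /\ n0 < n1).
  by apply: (IH n1 p1); have := ub _ p1; lia.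
exists n0; split=> // n' p'; rewrite leqNgt; apply/negP => h'; apply: no.
by exists n'.
Qed.

(** * Longest paths *)

Section Graph.
Variables (T : finType) (e : rel T).

Definition nbr u := [set v | e u v].
Definition cycles_ok := forall s, uniq s -> cycle e s -> 2 < size s -> size s %% 4 <> 2.

(** An empty [s] covers the case [p' = q']. *)
Definition twin_pair := exists p q x y p' q' s,
  [/\ p <> q, x <> y, nbr p = [set x; y; p'], nbr q = [set x; y; q'] &
   [/\ path e p' s, last p' s = q' & {in p' :: s, forall v, v \notin [:: p; q; x; y]}]].

Definition small_block := exists a b c d r,
  [/\ uniq [:: a; b; c; d; r], cycle e [:: a; b; c; d; r] & {in [:: a; b; c; d], forall u v, e u v -> v \in [:: a; b; c; d; r]}].

Hypothesis esym : symmetric e.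
Hypothesis eirr : irreflexive e.
Hypothesis ok : cycles_ok.
(** Only vertices with a neighbour are constrained, because elements of [T] outside the current
    vertex set are isolated. *)
Hypothesis min3 : forall u v, e u v -> 2 < #|nbr u|.
Hypothesis adj4 : forall u v, e u v -> 3 < #|nbr u| \/ 3 < #|nbr v|.

Section LongestPath.
Variables (n : nat) (b : nat) (x : T) (s' : seq T).
Let s := x :: s'.
Let f i := nth x s i.
Hypothesis us : uniq s.
Hypothesis ps : path e x s'.
Hypothesis ns : size s = n.
Hypothesis nmax : forall y t, uniq (y :: t) -> path e y t -> size (y :: t) <= n.
Hypothesis bn : b < n.
Hypothesis xb : e x (f b).
Hypothesis bmax : forall y t i, uniq (y :: t) -> path e y t -> size (y :: t) = n ->
  i < n -> e y (nth y (y :: t) i) -> i <= b.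

Let E : rel nat := fun i j => e (f i) (f j).
Let w := b.-1.

Lemma f_inj i j : i <= b -> j <= b -> f i = f j -> i = j.
Proof. by move=> ib jb /eqP; rewrite nth_uniq // ?ns; [move/eqP|lia|lia]. Qed.

Lemma longest_nbr y t v : uniq (y :: t) -> path e y t -> size (y :: t) = n -> e y v -> v \in y :: t.
Proof.
move=> u p sz h; apply/negPn/negP => nv.
have : size (v :: y :: t) <= n by apply: nmax; rewrite /= ?nv //= esym h.
by rewrite /= in sz *; lia.
Qed.

Lemma step_E i : i < b -> E i i.+1.
Proof. by move=> ib; have /(pathP x) := ps; apply; have := ns; rewrite /s /=; lia. Qed.

(** The start of the path is rerouted and nothing moves from index [b] on, so that indices beyond
    [b] can be compared with [bmax]. *)
Lemma end_path t : hampath_end b E t -> exists t',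
  [/\ perm_eq (f t :: t') s, path e (f t) t' &
      forall y i, b <= i -> i < n -> nth y (f t :: t') i = f i].
Proof.
move=> [l [pl pE lb]]; exists ([seq f i | i <- l] ++ drop b.+1 s); split.
- rewrite -[_ :: _]/([seq f i | i <- t :: l] ++ drop b.+1 s).
  have tk : [seq f i | i <- iota 0 b.+1] = take b.+1 s by rewrite map_nth_iota0 ?ns.
  by rewrite -[X in perm_eq _ X](cat_take_drop b.+1 s) perm_cat2r -tk perm_map.
- rewrite cat_path path_map pE /= last_map lb.
  have bs : b < size s by rewrite ns.
  by have := drop_sorted b (ps : sorted e s); rewrite (drop_nth x bs).
have -> : f t :: ([seq f i | i <- l] ++ drop b.+1 s) = [seq f i | i <- t :: l] ++ drop b.+1 s by [].
move=> y i; have mlen : size (t :: l) = b.+1 by rewrite (perm_size pl) size_iota.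
rewrite leq_eqVlt => /orP[/eqP <- _|bi ii].
  rewrite nth_cat size_map mlen ltnSn.
  have lb' : nth 0 (t :: l) (size (t :: l)).-1 = b by rewrite nth_last.
  by rewrite (nth_map 0) ?mlen //; rewrite mlen in lb'; rewrite lb'.
rewrite nth_cat size_map mlen ltnNge bi [~~ _]/=.
by rewrite nth_drop subnKC // (set_nth_default x) // ns.
Qed.

(** Maximal length puts the neighbour on the rerouted path, and the maximality of [b] bounds its
    index. *)
Lemma closed_end t v : hampath_end b E t -> e (f t) v -> exists2 i, i <= b & v = f i.
Proof.
move=> ht h; have [t' [p1 q1 hn]] := end_path ht.
have u1 : uniq (f t :: t') by rewrite (perm_uniq p1).
have sz : size (f t :: t') = n by rewrite (perm_size p1).
have vs : v \in s by rewrite -(perm_mem p1); apply: longest_nbr h.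
have iv : index v s < n by rewrite -ns index_mem.
exists (index v s); last by rewrite /f nth_index.
rewrite leqNgt; apply/negP => bi.
suff H : e (f t) (nth (f t) (f t :: t') (index v s)).
  by have := bmax u1 q1 sz iv H; rewrite leqNgt bi.
by rewrite hn ?(ltnW bi) // /f nth_index.
Qed.

Lemma E_sym : symmetric E. Proof. by move=> i j; apply: esym. Qed.

Lemma E_irr : irreflexive E. Proof. by move=> i; apply: eirr. Qed.

Lemma E_ok l : uniq l -> all (fun i => i <= b) l -> cycle E l -> 2 < size l -> size l %% 4 <> 2.
Proof.
move=> ul al cl; rewrite -(size_map f); apply: ok; last by rewrite cycle_map.
rewrite map_inj_in_uniq // => i j /(allP al) ib /(allP al) jb; exact: f_inj.
Qed.

Lemma card_gt_witness (t : nat) (l : seq nat) : hampath_end b E t -> size l < #|nbr (f t)| ->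
  exists c, [/\ c <= b, E t c & c \notin l].
Proof.
move=> ht h.
have [v vn vl] : exists2 v, v \in nbr (f t) & v \notin [seq f i | i <- l].
  apply/subsetPn; apply/negP => /subset_leq_card le.
  by have := leq_trans h (leq_trans le (card_size _)); rewrite size_map ltnn.
rewrite inE in vn; have [c cb ev] := closed_end ht vn.
exists c; split=> //; first by rewrite /E -ev.
by apply: contra vl => cl; rewrite ev map_f.
Qed.

Lemma hampath_end_deg3 t : hampath_end b E t -> forall a1 a2, exists c, [/\ c <= b, E t c, c <> a1 & c <> a2].
Proof.
move=> ht a1 a2.
have [c [cb h]] : exists c, c <= b /\ E t c.
  case: ht => -[|c l] [pl pE lb].
    have := perm_size pl; rewrite size_iota /= => -[b0].
    by move: xb; rewrite -b0 /f /= eirr.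
  exists c; case/andP: pE => -> _; split=> //.
  have : c \in iota 0 b.+1 by rewrite -(perm_mem pl) !inE eqxx orbT.
  by rewrite mem_iota; lia.
have [|d [db hd]] := @card_gt_witness t [:: a1; a2] ht; first exact: min3 h.
by rewrite !inE negb_or => /andP[/eqP d1 /eqP d2]; exists d.
Qed.

Lemma end_deg4 t : hampath_end b E t -> 3 < #|nbr (f t)| -> deg4 b E t.
Proof.
move=> ht h a1 a2 a3; have [d [db hd]] := @card_gt_witness t [:: a1; a2; a3] ht h.
by rewrite !inE !negb_or => /and3P[/eqP d1 /eqP d2 /eqP d3]; exists d.
Qed.

Lemma hampath_end_adj_deg4 t t' : hampath_end b E t -> hampath_end b E t' -> E t t' ->
  deg4 b E t \/ deg4 b E t'.
Proof. by move=> h h' /adj4 [] d; [left|right]; apply: end_deg4. Qed.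

Lemma b_gt2 : 2 < b.
Proof.
have b0 : b != 0 by apply/negP => /eqP b0; move: xb; rewrite b0 /f /= eirr.
have T0 : hampath_end b E 0.
  have [t [st pt lt]] := seg_path E_sym step_E (leq0n b) (leqnn b).
  by exists t; rewrite -st /seg leq0n subn0.
have [c [cb h c1 c2]] := hampath_end_deg3 T0 1 b.
have c0 : c <> 0 by move=> c0; move: h; rewrite c0 /E eirr.
by lia.
Qed.

Lemma seg_walk i j : i <= b -> j <= b -> exists t,
  [/\ path e (f i) t, last (f i) t = f j & {subset f i :: t <= [seq f k | k <- seg i j]}].
Proof.
move=> ib jb; have [t [st pt lt]] := seg_path E_sym step_E ib jb.
exists [seq f k | k <- t]; split; first by rewrite path_map.
  by rewrite last_map lt.
by rewrite st.
Qed.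

Lemma twins_graph : twins w b E -> twin_pair.
Proof.
move=> [p [q [x0 [y0 [p' [q' [[tp tq pq xy] [pb qb x0b y0b pqw] [[px py pp'] [qx qy qq']] [np nq] sg]]]]]]].
have nE t x1 y1 z1 : hampath_end b E t -> E t x1 -> E t y1 -> E t z1 -> nbrs_among b E t x1 y1 z1 ->
   nbr (f t) = [set f x1; f y1; f z1].
  move=> ht h1 h2 h3 n3; apply/setP => v; rewrite !inE; apply/idP/idP.
    by move=> h; have [c cb ev] := closed_end ht h; rewrite ev in h *; case: (n3 c cb h) => [->|[->|->]]; rewrite eqxx ?orbT.
  by case/orP => [/orP[]|] /eqP->.
have pqb : maxn p' q' <= b.-1 := pqw.
have [t [pt lt st]] := @seg_walk p' q' ltac:(lia) ltac:(lia).
exists (f p), (f q), (f x0), (f y0), (f p'), (f q'), t; split.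
- by move/(f_inj pb qb).
- by move/(f_inj x0b y0b).
- exact: nE.
- exact: nE.
split=> // v /st /mapP[i]; rewrite mem_seg => hi ->.
have ib : i <= b by lia.
have [i1 i2 i3 i4] := sg i hi; rewrite !inE !negb_or.
by apply/and4P; split; apply/eqP => /f_inj; auto.
Qed.

Lemma small_graph : small_cycle b E -> small_block.
Proof.
move=> [b4 [t0 t1 t2 t3]]; exists (f 0), (f 1), (f 2), (f 3), (f 4); split.
- have : uniq (map f (iota 0 5)) by rewrite map_inj_in_uniq ?iota_uniq // => i j; rewrite !mem_iota => ib jb; apply: f_inj; lia.
  by [].
- have st i : i < 4 -> e (f i) (f i.+1) by rewrite -b4; apply: step_E.
  by rewrite /cycle rcons_path [path _ _ _]/= !st //= esym -b4.
move=> u uin v h; have [i ib ->] : exists2 i, i <= b & v = f i.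
  by move: uin; rewrite !inE => /or4P[] /eqP eu; rewrite eu in h; apply: closed_end h.
move: ib; rewrite b4; case: i => [|[|[|[|[|i]]]]] //; rewrite !inE eqxx ?orbT //.
Qed.

Lemma head_outcome : ~~ e x (f w) \/ 3 < #|nbr x| -> twin_pair \/ small_block.
Proof.
have b3 := b_gt2; have bw : b = w.+1 by rewrite /w; lia.
have w2 : 1 < w by rewrite /w; lia.
have E0b : E 0 b by [].
have fin : twins w b E \/ small_cycle b E -> twin_pair \/ small_block.
  by case=> [/twins_graph|/small_graph]; [left|right].
move=> h; apply: fin; have [h0|h0] := boolP (E 0 w).
  case: h => [|h]; first by rewrite -[e x _]/(E 0 w) h0.
  apply: (adjacent_outcome bw E_sym E_irr step_E E0b w2 E_ok hampath_end_deg3 hampath_end_adj_deg4 h0).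
  by apply: end_deg4 => //; apply: (hampath_end_0 bw E_sym step_E E0b w2).
exact: (nonadjacent_outcome bw E_sym E_irr step_E E0b w2 E_ok hampath_end_deg3 hampath_end_adj_deg4 h0).
Qed.

(** This exchanges the roles of [x] and [f w] when they are adjacent and it is [f w] that is known
    to have degree at least 4. *)
Lemma other_end : exists t', [/\ uniq (f w :: t'), path e (f w) t', size (f w :: t') = n &
  e (f w) (nth (f w) (f w :: t') b)].
Proof.
have b3 := b_gt2; have bw : b = w.+1 by rewrite /w; lia.
have w2 : 1 < w by rewrite /w; lia.
have [t' [p1 q1 hn]] := end_path (hampath_end_w bw E_sym step_E xb w2).
exists t'; split=> //; [by rewrite (perm_uniq p1)|by rewrite (perm_size p1)|].
rewrite hn //; suff : E w b by [].
by have := @step_E w; rewrite -bw; apply; rewrite /w; lia.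
Qed.
End LongestPath.

Theorem twin_pair_or_small_block u v : e u v -> twin_pair \/ small_block.
Proof.
move=> uv.
have [n [[x [t [ut pt st]]] nm]] : exists n, (exists y t, [/\ uniq (y :: t), path e y t & size (y :: t) = n]) /\
   forall m, (exists y t, [/\ uniq (y :: t), path e y t & size (y :: t) = m]) -> m <= n.
  apply: (@ex_max _ 1 #|T|); first by exists u, [::].
  by move=> m [y [t [h _ <-]]]; rewrite -(card_uniqP h) max_card.
have nmax y t' : uniq (y :: t') -> path e y t' -> size (y :: t') <= n.
  by move=> h1 h2; apply: nm; exists y, t'.
have n2 : 1 < n by apply: (nmax u [:: v]); rewrite /= ?uv // inE andbT; apply/eqP => euv; rewrite euv eirr in uv.
have [b [[y [t' [[u1 p1 s1] bn h1]]] bm]] : exists b,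
   (exists y t, [/\ [/\ uniq (y :: t), path e y t & size (y :: t) = n], b < n & e y (nth y (y :: t) b)]) /\
   forall c, (exists y t, [/\ [/\ uniq (y :: t), path e y t & size (y :: t) = n], c < n & e y (nth y (y :: t) c)]) -> c <= b.
  apply: (@ex_max _ 1 n); last by move=> m [y [t' [_ h _]]]; lia.
  case: t ut pt st => [|z t'] ut pt st; first by rewrite -st in n2.
  by exists x, (z :: t'); split=> //; case/andP: pt.
have bmax y0 t0 i : uniq (y0 :: t0) -> path e y0 t0 -> size (y0 :: t0) = n -> i < n ->
    e y0 (nth y0 (y0 :: t0) i) -> i <= b.
  by move=> *; apply: bm; exists y0, t0.
have [h|h] := boolP (e y (nth y (y :: t') b.-1)); last first.
  by apply: (head_outcome u1 p1 s1 nmax bn h1 bmax); left.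
have [h'|h'] := adj4 h; first by apply: (head_outcome u1 p1 s1 nmax bn h1 bmax); right.
have [t0 [u0 p0 s0 h0]] := other_end u1 p1 s1 nmax bn h1 bmax.
by apply: (head_outcome u0 p0 s0 nmax bn h0 bmax); right.
Qed.
End Graph.

(** * Identifying vertices next to twins *)

Section Jump.
Variables (T : finType) (e : rel T).

(** The path is followed up to its first vertex in [Q]; [a] is the last vertex in [P] before it, and
    [J] collects what comes after [a]. *)
Lemma first_jump (P Q : pred T) u s : (forall v, P v -> ~~ Q v) ->
  path e u s -> uniq (u :: s) -> P u -> Q (last u s) ->
  exists a J c, [/\ P a, Q c, path e a (rcons J c), uniq J &
    {in J, forall v, [&& v \in u :: s, ~~ P v & ~~ Q v]}].
Proof.
move=> PQ; suff H (r : seq T) a J : {subset a :: J ++ r <= u :: s} -> path e a (J ++ r) -> uniq (a :: J ++ r) ->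
    P a -> Q (last a (J ++ r)) -> {in J, forall v, ~~ P v && ~~ Q v} ->
    exists a J c, [/\ P a, Q c, path e a (rcons J c), uniq J &
      {in J, forall v, [&& v \in u :: s, ~~ P v & ~~ Q v]}].
  by move=> *; apply: (H s u [::]).
elim: r a J => [|v r IH] a J sub p un Pa Ql nJ.
  rewrite cats0 in Ql; have := mem_last a J; rewrite inE => /orP[/eqP el|/nJ]; last by rewrite Ql andbF.
  by move: Ql; rewrite el; have := PQ _ Pa; move/negPf => ->.
have [Qv|nQ] := boolP (Q v).
  exists a, J, v; split=> //.
  - by move: p; rewrite -cat_rcons cat_path => /andP[].
  - by move: un; rewrite /= cat_uniq => /andP[_] /andP[].
  - by move=> w wJ; rewrite nJ // andbT; apply: sub; rewrite inE mem_cat wJ orbT.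
have [Pv|nP] := boolP (P v).
  apply: (IH v [::]) => //=.
  - by move=> w ws; apply: sub; rewrite inE mem_cat ws !orbT.
  - by move: p; rewrite cat_path /= => /and3P[].
  - by move: un; rewrite /= cat_uniq => /andP[_] /and3P[].
  - by move: Ql; rewrite last_cat.
apply: (IH a (rcons J v)); rewrite ?cat_rcons // => w; rewrite mem_rcons inE => /orP[/eqP ->|/nJ //].
by rewrite nP.
Qed.

Variables (b : nat) (g : nat -> T).
Hypothesis esym : symmetric e.
Hypothesis ok : cycles_ok e.
Hypothesis g_inj : forall i j, i <= b -> j <= b -> g i = g j -> i = j.
Hypothesis gstep : forall i, i < b -> e (g i) (g i.+1).
Let E : rel nat := fun i j => e (g i) (g j).

(** The analogue of [cycle_of_walk] in which the closing edge is a path through [J], outside the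
    indexed vertices. *)
Lemma cycle_through J i k l : within b ((i, k) :: l) -> chain E k l ->
  path e (g (last k [seq p.2 | p <- l])) (rcons J (g i)) -> uniq J ->
  (forall v j, j <= b -> v \in J -> v <> g j) ->
  allapart ((i, k) :: l) ->
  2 < wsize ((i, k) :: l) + size J -> (wsize ((i, k) :: l) + size J) %% 4 <> 2.
Proof.
move=> h1 h2 h3 h4 h5 h6.
have Esym : symmetric E by move=> x y; apply: esym.
rewrite -size_walk -(size_map g) -size_cat; apply: ok.
  rewrite cat_uniq h4 andbT map_inj_in_uniq ?walk_uniq //=; last first.
    by move=> x y /(walk_within h1) xb /(walk_within h1) yb; apply: g_inj.
  by apply/hasPn => v vJ; apply/negP => /mapP[j /(walk_within h1) jb]; apply: h5.
have [s [-> g2 g3]] := walk_path Esym gstep h1 h2.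
by rewrite /= rcons_cat cat_path path_map g2 last_map g3.
Qed.

(* The path p, p', ..., q', q is indexed by 0, ..., b, so that the common
   neighbours x, y of the twins, at positions X < Y, give chords at both ends. *)
Variables X Y : nat.
Hypothesis b4 : b %% 4 = 0.
Hypothesis X1 : 1 < X.
Hypothesis XY : X < Y.
Hypothesis Yb : Y.+1 < b.
Hypothesis pX : E 0 X.
Hypothesis pY : E 0 Y.
Hypothesis qX : E b X.
Hypothesis qY : E b Y.

Ltac adj := first [ exact: pX | exact: pY | exact: qX | exact: qY
  | rewrite /E esym; first [ exact: pX | exact: pY | exact: qX | exact: qY ] ].
Ltac olia := repeat match goal with H : context [_ %% _] |- _ => clear H end;
  repeat match goal with H : context [e] |- _ => clear H end;
  repeat match goal with H : context [g] |- _ => clear H end; lia.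
Ltac cyc J i k l n := let H := fresh "cy" in
  have H : n %% 4 <> 2;
  [ replace n with (wsize ((i, k) :: l) + size J)
      by (cbn [wsize size]; olia);
    apply: (@cycle_through J i k l);
    cbn [within chain allapart apart wsize map last fst snd];
    [ repeat split; olia | repeat split; adj
    | first [assumption | (rewrite /= andbT; adj)] | first [assumption|done]
    | first [assumption|done] | repeat split; olia | olia ] | ].

(* J is the interior of a path leaving the arc before X for the arc after X. *)
Lemma no_jump a c J : 0 < a -> a < X -> X < c -> c < b -> c <> Y ->
  path e (g a) (rcons J (g c)) -> uniq J ->
  (forall v j, j <= b -> v \in J -> v <> g j) -> False.
Proof.
move=> a0 aX Xc cb cY pJ uJ dJ.
(* The parities of [X] and [Y] and the residue of their difference come from cycles that do not use
   the jump. *)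
have X2 : X %% 2 = 0.
  cyc (@nil T) 0 X (@nil (nat * nat)) X.+1.
  cyc (@nil T) 0 X [:: (b, b); (Y, Y)] (X + 3).
  by move: cy cy0; clear; lia.
have Y2 : Y %% 2 = 0.
  cyc (@nil T) Y b (@nil (nat * nat)) (b - Y).+1.
  cyc (@nil T) Y b [:: (X, X); (0, 0)] (b - Y + 3).
  by move: cy cy0; clear - b4 Yb; lia.
have XY2 : Y %% 4 = (X + 2) %% 4.
  cyc (@nil T) X Y [:: (0, 0)] (Y - X + 2).
  by move: cy; clear - X2 Y2 XY; lia.
have [o|o] : Y < c \/ c < Y by clear - cY; lia.
(* The first two cycles make [c + a + size J] even and the other two make it odd. *)
- cyc J c b [:: (X, X); (0, a)] (b - c + a + size J + 3).
  cyc J c b [:: (Y, X); (0, a)] (b - c + (Y - X) + a + size J + 3).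
  cyc J c Y [:: (0, a)] (c - Y + a + size J + 2).
  cyc J c Y [:: (b, b); (X, X); (0, a)] (c - Y + a + size J + 4).
  move: (size J) cy cy0 cy1 cy2 => m h1 h2 h3 h4.
  have P1 : (c + a + m) %% 2 = 0.
    have d : (Y - X) %% 4 = 2 by clear - XY2 XY; lia.
    move: (Y - X) d h1 h2 => z; clear - b4 cb; lia.
  by move: h3 h4; clear - P1 Y2 o; lia.
(* With [c] between [X] and [Y], the first two cycles make [c + a + size J] odd, and the other four
   exclude the remaining residues. *)
cyc J c Y [:: (0, a)] (Y - c + a + size J + 2).
cyc J c Y [:: (b, b); (X, X); (0, a)] (Y - c + a + size J + 4).
cyc J c X [:: (b, Y); (0, a)] (c - X + (b - Y) + a + size J + 3).
cyc J c b [:: (X, X); (0, a)] (b - c + a + size J + 3).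
cyc J c a (@nil (nat * nat)) (c - a + size J + 1).
cyc J c Y [:: (0, 0); (X, a)] (Y - c + (X - a) + size J + 3).
move: (size J) cy cy0 cy1 cy2 cy3 cy4 => m h0 h1 h2 h3 h4 h5.
have P1 : (c + a + m) %% 2 = 1 by move: h0 h1; clear - Y2 o; lia.
have P2 : (c + a + m + 3) %% 4 = (X + Y) %% 4 by move: h2; clear - P1 b4 X2 Y2 Xc Yb; lia.
have P3 : (a + m + 3) %% 4 = c %% 4 by move: h3; clear - P1 b4 cb; lia.
have {}h4 : (c - a) %% 2 = 1 by move: h4; clear - P1 P2 P3 X2 XY2 aX Xc; lia.
by move: h5; clear - h4 P1 P2 P3 X2 Y2 aX Xc o; lia.
Qed.
End Jump.

(** * Paths between the third neighbours of twins *)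

Section Twins.
Variables (T : finType) (e : rel T).
Hypothesis esym : symmetric e.
Hypothesis eirr : irreflexive e.
Hypothesis ok : cycles_ok e.

(** If the length [(size s).+1] were 2 modulo 4, extending the path by [p] and [q] would give a path
    [W] whose length is divisible by 4. The path [r] avoids [x], so it contains a jump from before
    [x] to after [x], against [no_jump]. *)
Lemma twins_far_ordered p q x y p' q' r s :
  p <> q -> e p x -> e p y -> e p p' -> e q x -> e q y -> e q q' ->
  path e p' r -> last p' r = q' -> {in p' :: r, forall v, v \notin [:: p; q; x; y]} ->
  path e p' (rcons s q') -> uniq (p' :: rcons s q') -> p \notin s -> q \notin s ->
  x \in s -> index x s < index y s -> y \in s -> (size s).+1 %% 4 <> 2.
Proof.
move=> pq px py pp' qx qy qq' pr lr rn ps us np nq xs xy ys hs.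
move: lr; case/shortenP: pr => r0 pr0 ur0 sub0 lr0.
have rn0 v : v \in p' :: r0 -> v \notin [:: p; q; x; y].
  by rewrite inE => /orP[/eqP->|/sub0 h]; apply: rn; rewrite inE ?eqxx // h orbT.
have p'r : p' \in p' :: r0 by rewrite inE eqxx.
have q'r : q' \in p' :: r0 by rewrite -lr0 mem_last.
pose W := [:: p, p' & rcons (rcons s q') q].
have sW : size W = (size s + 3).+1 by rewrite /W /= !size_rcons addn3.
have uW : uniq W.
  have := rn0 _ p'r; have := rn0 _ q'r; rewrite !inE !negb_or => /and4P[n1 n2 n3 n4] /and4P[m1 m2 m3 m4].
  rewrite /W /= rcons_uniq !mem_rcons !inE !mem_rcons !inE !negb_or.
  move: us; rewrite /= rcons_uniq mem_rcons inE negb_or => /andP[/andP[a1 a2] /andP[a3 a4]].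
  rewrite mem_rcons inE negb_or (eq_sym p p') m1 (eq_sym p q') n1 np (eq_sym q q') n2 nq m2 a1 a2 a3 a4 !andbT.
  by rewrite ?andbT; apply/eqP.
have pW : sorted e W.
  by rewrite /W /= pp' rcons_path ps last_rcons esym qq'.
pose b := size s + 3; pose g i := nth p W i.
have g_inj i j : i <= b -> j <= b -> g i = g j -> i = j.
  by move=> ib jb /eqP; rewrite nth_uniq ?sW // => /eqP.
have gstep i : i < b -> e (g i) (g i.+1).
  by move=> ib; move: pW => /(pathP p); apply; rewrite -ltnS -[(size _).+1]/(size W) sW.
have gW v : v \in W -> g (index v W) = v by apply: nth_index.
have iW v : v \in W -> index v W <= b by rewrite -index_mem sW.
have p's v : v \in s -> v != p'.
  by move=> vs; apply: contraL us => /eqP <-; rewrite /= mem_rcons inE vs orbT.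
have iS v : v \in s -> index v W = (index v s).+2.
  move=> vs; rewrite /W /= (eq_sym p) (eq_sym p') (negPf (p's _ vs)).
  have -> : v == p = false by apply: contraNF np => /eqP <-.
  by rewrite -!cats1 !index_cat mem_cat vs.
pose X := index x W; pose Y := index y W.
have eX : X = (index x s).+2 by apply: iS.
have eY : Y = (index y s).+2 by apply: iS.
have xW : x \in W by rewrite !(inE, mem_rcons) xs !orbT.
have yW : y \in W by rewrite !(inE, mem_rcons) ys !orbT.
have ysz : index y s < size s by rewrite index_mem.
have gb : g b = q.
  by rewrite /g /b -[_ + _]/(_.+1.-1) -sW nth_last /= last_rcons.
(* Off [W] the index is [size W], that is [b.+1], so vertices outside [W] lie neither in [P] nor in
   [Q]. *)
pose P := [pred v | 0 < index v W < X].
pose Q := [pred v | (X < index v W < b) && (v != y)].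
have [] := @first_jump T e P Q p' r0 _ pr0 ur0.
- by move=> v /= /andP[_ h]; rewrite [X < _]ltnNge (ltnW h).
- have n1 : p == p' = false by apply: contraTF pp' => /eqP ->; rewrite eirr.
  by change (0 < index p' W < X); rewrite {1 2}/W /= n1 eqxx eX.
- rewrite lr0; change ((X < index q' W < b) && (q' != y)).
  have := rn0 _ q'r; rewrite !inE !negb_or => /and4P[m1 m2 m3 ->].
  have q'n : nth p W (size s).+2 = q' by rewrite /W /= nth_rcons size_rcons ltnSn nth_rcons ltnn eqxx.
  have iq : index q' W = (size s).+2 by rewrite -{1}q'n index_uniq // sW addn3.
  rewrite iq andbT eX /b addn3 ltnSn andbT !ltnS.
  by rewrite index_mem.
move=> a [J [c [Pa /andP[Qc cy] pJ uJ dJ]]].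
have aW : a \in W.
  by rewrite -index_mem sW; case/andP: Pa => _ h; apply: (leq_trans h); apply: (leq_trans (iW _ xW)).
have cW : c \in W by rewrite -index_mem sW; case/andP: Qc => _ h; apply: (leq_trans h).
apply: (@no_jump T e b g esym ok g_inj gstep X Y _ _ _ _ _ _ _ _ (index a W) (index c W) J).
- by rewrite /b; clear - hs; lia.
- by rewrite eX.
- by rewrite eX eY.
- by rewrite eY /b; clear - ysz; lia.
- by rewrite /X gW.
- by rewrite /Y gW.
- by rewrite gb /X gW.
- by rewrite gb /Y gW.
- by move: Pa => /andP[].
- by move: Pa => /andP[].
- by move: Qc => /andP[].
- by move: Qc => /andP[].
- by move=> h; move: cy; rewrite -[c]gW // h /Y gW // eqxx.
- by rewrite !gW.
- by [].
move=> v j jb /dJ /and3P[vr nP nQ] vj.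
have jv : index v W = j by rewrite vj /g index_uniq // sW.
have := rn0 v vr; rewrite !inE !negb_or => /and4P[v1 v2 v3 v4].
have [j0|[jX|[jB|hj]]] : j = 0 \/ j = X \/ j = b \/ (0 < j < X \/ X < j < b) by clear - jb; lia.
- by move: v1; rewrite vj j0 eqxx.
- by move: v3; rewrite vj jX /X gW // eqxx.
- by move: v2; rewrite vj jB gb eqxx.
case: hj => hj.
  by move: nP; change (~~ (0 < index v W < X) -> False); rewrite jv hj.
by move: nQ; change (~~ ((X < index v W < b) && (v != y)) -> False); rewrite jv hj v4.
Qed.

(** The detour [q' q x p p'] of length 4 closes the path to a cycle with the same length modulo
    4. *)
Lemma twins_close p q x p' q' s : p <> q -> e p x -> e p p' -> e q x -> e q q' ->
  x <> p' -> x <> q' -> p <> q' -> q <> p' ->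
  path e p' (rcons s q') -> uniq (p' :: rcons s q') -> p \notin s -> q \notin s ->
  x \notin s -> (size s).+1 %% 4 <> 2.
Proof.
move=> pq px pp' qx qq' xp' xq' pq' qp' ps us np nq nx.
have n1 : p <> p' by move=> h; rewrite h eirr in pp'.
have n2 : q <> q' by move=> h; rewrite h eirr in qq'.
have n3 : p <> x by move=> h; rewrite h eirr in px.
have n4 : q <> x by move=> h; rewrite h eirr in qx.
have : size (p' :: rcons s q' ++ [:: q; x; p]) %% 4 <> 2; last first.
  by rewrite /= size_cat size_rcons /=; clear; lia.
apply: ok.
- rewrite -cat_cons cat_uniq us /= !inE !mem_rcons !inE !negb_or np nq nx !andbT.
  by do ![apply/andP; split]; apply/eqP => h; move: n1 n2 n3 n4 pq xp' xq' pq' qp'; rewrite h.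
- by rewrite /= rcons_cat cat_path ps last_rcons /= (esym q') qq' qx (esym x) px pp'.
by rewrite /= size_cat addnC.
Qed.

Lemma twins_far p q x y p' q' r s :
  p <> q -> e p x -> e p y -> e p p' -> e q x -> e q y -> e q q' -> x <> y ->
  path e p' r -> last p' r = q' -> {in p' :: r, forall v, v \notin [:: p; q; x; y]} ->
  path e p' (rcons s q') -> uniq (p' :: rcons s q') -> p \notin s -> q \notin s ->
  (size s).+1 %% 4 <> 2.
Proof.
move=> pq px py pp' qx qy qq' xy pr lr rn ps us np nq.
have := rn p'; rewrite inE eqxx => /(_ isT); rewrite !inE !negb_or => /and4P[/eqP m1 /eqP m2 /eqP m3 /eqP m4].
have := rn q'; rewrite -{1}lr mem_last => /(_ isT); rewrite !inE !negb_or => /and4P[/eqP o1 /eqP o2 /eqP o3 /eqP o4].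
have [xs|xs] := boolP (x \in s); last first.
  by apply: (twins_close pq px pp' qx qq') => // h; [apply: m3|apply: o3|apply: o1|apply: m2].
have [ys|ys] := boolP (y \in s); last first.
  by apply: (twins_close pq py pp' qy qq') => // h; [apply: m4|apply: o4|apply: o1|apply: m2].
have [o|o|o] := ltngtP (index x s) (index y s).
- exact: (twins_far_ordered pq px py pp' qx qy qq' pr lr rn).
- apply: (twins_far_ordered pq py px pp' qy qx qq' pr lr _ ps us np nq ys o xs).
  by move=> v /rn; rewrite !inE !negb_or => /and4P[-> -> -> ->].
- by case: xy; rewrite -(nth_index x xs) o nth_index.
Qed.
End Twins.

(** * Deleting and identifying vertices *)

Section Counting.
Variable T : finType.
Implicit Types (e : rel T) (A Z : {set T}).

(* Ordered pairs: twice the number of edges. *)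
Definition arcs e : nat := #|[set p : T * T | e p.1 p.2]|.
(* Graphs on a fixed type with all edges inside A, so that the induction on the
   number of vertices needs no subtypes. *)
Definition supported A e := forall u v, e u v -> u \in A.

Definition del e w : rel T := fun u v => [&& e u v, u != w & v != w].

Lemma del_sub e w u v : del e w u v -> e u v. Proof. by case/and3P. Qed.

Lemma del_sym e w : symmetric e -> symmetric (del e w).
Proof. by move=> es u v; rewrite /del es [(u != w) && _]andbC. Qed.

Lemma del_irr e w : irreflexive e -> irreflexive (del e w).
Proof. by move=> ei u; rewrite /del ei. Qed.

Lemma cycles_ok_sub e e' : (forall u v, e' u v -> e u v) -> cycles_ok e -> cycles_ok e'.
Proof.
move=> sub ok s us cs; apply: ok => //; case: s cs {us} => //= x s; exact: sub_path.
Qed.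

Lemma del_supported A e w : symmetric e -> supported A e -> supported (A :\ w) (del e w).
Proof. by move=> es sA u v /and3P[h uw _]; rewrite !inE uw (sA _ _ h). Qed.

Lemma arcs_del e w : symmetric e -> arcs e <= arcs (del e w) + 2 * #|nbr e w|.
Proof.
move=> es; rewrite /arcs.
have : [set p : T * T | e p.1 p.2] \subset [set p | del e w p.1 p.2] :|:
   ([set (w, v) | v in nbr e w] :|: [set (v, w) | v in nbr e w]).
  apply/subsetP => -[u v]; rewrite !inE /del /= => h; rewrite h /=.
  have [uw|uw] /= := eqVneq u w.
    by apply/orP; left; apply/imsetP; exists v; rewrite ?inE -?uw.
  have [vw|vw] //= := eqVneq v w.
  by apply/orP; right; apply/imsetP; exists u; rewrite ?inE -?vw // es.
move=> /subset_leq_card /leq_trans; apply; apply: (leq_trans (leq_card_setU _ _)).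
rewrite leq_add2l; apply: (leq_trans (leq_card_setU _ _)).
by rewrite mul2n -addnn leq_add // leq_imset_card.
Qed.

Lemma nbr_del e w u : nbr (del e w) u \subset nbr e u :\ w.
Proof. by apply/subsetP => v; rewrite !inE => /and3P[-> _ ->]. Qed.

Lemma del_path_notin e w u s : path (del e w) u s -> w \notin s.
Proof.
elim: s u => //= v s IH u /andP[/and3P[_ _ vw] p].
by rewrite inE negb_or eq_sym vw (IH v).
Qed.

(** * Identification of a set of vertices *)

Section Collapse.
Variables (e : rel T) (Z : {set T}) (z : T).
Hypothesis esym : symmetric e.
Hypothesis eirr : irreflexive e.
Hypothesis ok : cycles_ok e.
Hypothesis zZ : z \in Z.
Hypothesis noZ : forall z1 z2 s, z1 \in Z -> z2 \in Z -> z1 <> z2 -> path e z1 (rcons s z2) ->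
  uniq s -> {in s, forall v, v \notin Z} -> (size s).+1 %% 4 <> 2.

Definition fold_to u := if u \in Z then z else u.
(** The quotient by [Z] on the same type: [z] represents the class, the rest of [Z] becomes
    isolated, and loops are dropped. *)
Definition collapse : rel T := fun u v => (u != v) &&
  [exists u', exists v', [&& e u' v', fold_to u' == u & fold_to v' == v]].

Lemma collapse_sym : symmetric collapse.
Proof.
move=> u v; rewrite /collapse eq_sym; congr andb; apply/existsP/existsP => -[a /existsP[c /and3P[h1 h2 h3]]];
  by exists c; apply/existsP; exists a; rewrite esym h1 h2 h3.
Qed.

Lemma collapse_irr : irreflexive collapse.
Proof. by move=> u; rewrite /collapse eqxx. Qed.

Lemma collapse_out u v : u \notin Z -> v \notin Z -> collapse u v -> e u v.
Proof.
rewrite /collapse /fold_to => uZ vZ /andP[_ /existsP[a /existsP[c /and3P[h /eqP h2 /eqP h3]]]].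
move: h2 h3; case: ifP => aZ; first by move=> zu; rewrite -zu zZ in uZ.
by move=> <-; case: ifP => cZ; [move=> zv; rewrite -zv zZ in vZ|move=> <-].
Qed.

Lemma collapse_left v : v \notin Z -> collapse z v -> exists2 a, a \in Z & e a v.
Proof.
rewrite /collapse /fold_to => vZ /andP[_ /existsP[a /existsP[c /and3P[h /eqP h2 /eqP h3]]]].
exists a; first by move: h2; case: ifP => // aZ az; rewrite az zZ in aZ.
by move: h3; case: ifP => cZ; [move=> zv; rewrite -zv zZ in vZ|move=> <-].
Qed.

Lemma collapse_in u v : collapse u v -> u \in Z -> u = z.
Proof.
rewrite /collapse /fold_to => /andP[_ /existsP[a /existsP[c /and3P[_ /eqP <- _]]]].
by case: ifP => // ->.
Qed.

Lemma collapse_supported A : supported A e -> Z \subset A -> supported (A :\: (Z :\ z)) collapse.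
Proof.
move=> sA ZA u v h; rewrite !inE.
have [uZ|uZ] := boolP (u \in Z); first by rewrite (collapse_in h uZ) eqxx (subsetP ZA).
rewrite andbF /=; move: h; rewrite /collapse /fold_to => /andP[_ /existsP[a /existsP[c /and3P[h /eqP h2 _]]]].
move: h2; case: ifP => aZ; first by move=> zu; rewrite -zu zZ in uZ.
by move=> <-; apply: sA h.
Qed.

(** A cycle through [z] lifts to a walk of the same length in [e] between two vertices of [Z]. If
    these coincide it is a cycle of [e]; otherwise [noZ] applies. *)
Lemma collapse_ok : cycles_ok collapse.
Proof.
move=> s us cs sz.
have sZ u : u \in s -> u \in Z -> u = z.
  move=> us' uZ; have := next_cycle cs us' => h; exact: collapse_in h uZ.
have path_out u r : {in u :: r, forall v, v \notin Z} -> path collapse u r -> path e u r.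
  elim: r u => //= v r IH u hZ /andP[h p]; rewrite collapse_out ?IH ?hZ ?inE ?eqxx ?orbT //.
  by move=> x xr; apply: hZ; rewrite inE xr orbT.
have [zs|zs] := boolP (z \in s); last first.
  apply: ok => //; case: s us cs sz sZ zs => //= u r us cs sz sZ zs.
  apply: path_out cs => v; rewrite inE mem_rcons inE orbA orbb => vs; apply/negP => vZ.
  by move: zs; rewrite -(sZ v) // ?inE ?vs.
have [i r rs] := rot_to zs.
have cr : cycle collapse (z :: r) by rewrite -rs rot_cycle.
have ur : uniq (z :: r) by rewrite -rs rot_uniq.
have sr : size s = (size r).+1 by rewrite -(size_rot i) rs.
have rZ : {in r, forall v, v \notin Z}.
  move=> v vr; apply/negP => vZ; have vs : v \in s by rewrite -(mem_rot i) rs inE vr orbT.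
  by move: ur; rewrite /= -(sZ v vs vZ) vr.
rewrite sr; case/lastP: r cr ur rZ sr rs => [|r y] cr ur rZ sr rs; first by rewrite sr in sz.
have pr : path e (head y r) (behead (rcons r y)).
  move: cr; rewrite /= rcons_path; case: (r) rZ => [//|x r'] /= rZ /andP[/andP[_ p] _].
  exact: path_out p.
have hZ : head y r \notin Z by apply: rZ; case: (r) => [|x r'] /=; rewrite inE ?mem_rcons eqxx.
have yZ : y \notin Z by apply: rZ; rewrite mem_rcons inE eqxx.
have [z1 z1Z h1] : exists2 a, a \in Z & e a (head y r).
  by apply: collapse_left => //; move: cr; case: (r) => [|x r'] /= /andP[].
have [z2 z2Z h2] : exists2 a, a \in Z & e a y.
  apply: collapse_left => //; move: cr; rewrite /= rcons_path last_rcons => /andP[_].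
  by rewrite collapse_sym.
have pz : path e z1 (rcons r y).
  by move: h1 pr; case: (r) => [|x r'] /= ->.
have uz : uniq (rcons r y) by case/andP: ur.
have [e12|/eqP n12] := eqVneq z1 z2; last first.
  by apply: (noZ z1Z z2Z n12) => //; rewrite rcons_path pz last_rcons esym.
rewrite -[_.+1]/(size (z1 :: rcons r y)); apply: ok; last by rewrite /= -sr.
  by rewrite /= uz andbT; apply: contraL z1Z => h; rewrite (rZ _ h).
by rewrite /= rcons_path pz last_rcons esym e12.
Qed.

(** A common neighbour would be the middle of a path of length 2. *)
Lemma no_common u z1 z2 : z1 \in Z -> z2 \in Z -> u \notin Z -> e u z1 -> e u z2 -> z1 = z2.
Proof.
move=> h1 h2 uZ e1 e2; apply/eqP/negPn/negP => /eqP n12.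
have := @noZ z1 z2 [:: u] h1 h2 n12; apply => //=; first by rewrite esym e1 e2.
by move=> v; rewrite inE => /eqP ->.
Qed.

(** By [no_common] no two arcs with an end outside [Z] are merged, so only arcs inside [Z] are
    lost. *)
Lemma arcs_collapse : arcs e <= arcs collapse + #|Z| * #|Z|.-1.
Proof.
pose off := [set p : T * T | [&& p.1 \in Z, p.2 \in Z & p.1 != p.2]].
pose B := [set p : T * T | e p.1 p.2 & (p.1 \notin Z) || (p.2 \notin Z)].
have offc : #|off| = #|Z| * #|Z|.-1.
  have dc : #|[set (v, v) | v in Z]| = #|Z| by apply: card_imset => u v [].
  have : off :|: [set (v, v) | v in Z] = setX Z Z.
    apply/setP => -[u v]; rewrite !inE /=; apply/idP/idP.
      by case/orP => [/and3P[-> ->]//|/imsetP[w wZ [-> ->]]]; rewrite wZ.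
    case/andP => uZ vZ; rewrite uZ vZ /=; have [<-|] //= := eqVneq u v.
    by apply/imsetP; exists u.
  move/(congr1 (fun X : {set T * T} => #|X|)); rewrite cardsX cardsU dc.
  have -> : off :&: [set (v, v) | v in Z] = set0.
    by apply/setP => -[u v]; rewrite !inE /=; apply/negP => /andP[/and3P[_ _ /eqP uv] /imsetP[w _ [uw vw]]]; apply: uv; rewrite uw vw.
  rewrite cards0 subn0 => h; apply/eqP; rewrite -(eqn_add2r #|Z|) h.
  by case: #|Z| => // m; rewrite mulnS addnC.
have sub : [set p : T * T | e p.1 p.2] \subset B :|: off.
  apply/subsetP => -[u v]; rewrite !inE /= => h; rewrite h /=.
  case: (u \in Z) => //=; case: (v \in Z) => //=.
  by apply/eqP => uv; rewrite uv eirr in h.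
apply: (leq_trans (subset_leq_card sub)); apply: (leq_trans (leq_card_setU _ _)).
rewrite offc leq_add2r.
have inj : {in B &, injective (fun p : T * T => (fold_to p.1, fold_to p.2))}.
  move=> [u v] [u2 v2]; rewrite !inE /= => /andP[h1 n1] /andP[h2 n2] [].
  rewrite /fold_to; case: ifP => uZ; case: ifP => u2Z.
  - rewrite uZ u2Z /= in n1 n2; rewrite (negPf n1) (negPf n2) => _ vv.
    by subst v2; rewrite (@no_common v u u2) // esym.
  - by move=> zu; rewrite -zu zZ in u2Z.
  - by move=> zu; rewrite zu zZ in uZ.
  move=> uu; subst u2; case: ifP => vZ; case: ifP => v2Z.
  - by move=> _; rewrite (@no_common u v v2) // uZ.
  - by move=> zu; rewrite -zu zZ in v2Z.
  - by move=> zu; rewrite zu zZ in vZ.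
  - by move=> ->.
rewrite -(card_in_imset inj) /arcs; apply: subset_leq_card; apply/subsetP => p /imsetP[[u v]].
rewrite !inE /= => /andP[h n] -> /=; rewrite /collapse; apply/andP; split; last first.
  by apply/existsP; exists u; apply/existsP; exists v; rewrite h !eqxx.
apply/eqP; rewrite /fold_to; case: ifP => uZ; case: ifP => vZ.
- by rewrite uZ vZ in n.
- by move=> zv; rewrite -zv zZ in vZ.
- by move=> zv; rewrite zv zZ in uZ.
- by move=> uv; rewrite uv eirr in h.
Qed.
End Collapse.
End Counting.

(** * Induction on the number of vertices *)

Section Bound.
Variable T : finType.
Implicit Types (e : rel T) (A : {set T}).

(** In terms of edges the bound is [5 / 2 * (#|A| - 1)], which the extremal graphs attain. *)
Definition bounded n := forall A e, #|A| <= n -> 0 < #|A| -> symmetric e -> irreflexive e ->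
  supported A e -> cycles_ok e -> arcs e <= 5 * #|A|.-1.

(** Deleting [v] removes at most 4 arcs while the bound drops by 5; a single vertex is treated
    apart, since the induction needs a nonempty rest. *)
Lemma bound_small_degree n A e v : bounded n -> #|A| <= n.+1 -> symmetric e -> irreflexive e ->
  supported A e -> cycles_ok e -> v \in A -> #|nbr e v| <= 2 -> arcs e <= 5 * #|A|.-1.
Proof.
move=> IH An es ei sA ok vA dv; have cA := cardsD1 v A; rewrite vA in cA.
have [A1|A1] := posnP #|A :\ v|.
  rewrite /arcs; have -> : [set p : T * T | e p.1 p.2] = set0; last by rewrite cards0.
  apply/setP => -[x y]; rewrite !inE /=; apply/negP => h.
  have sub w : w \in A -> w = v.
    move=> wA; apply/eqP/negPn/negP => wv; move/eqP: A1; rewrite cards_eq0 => /eqP/setP/(_ w).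
    by rewrite !inE wv wA.
  have yx := h; rewrite es in yx.
  by have := h; rewrite (sub _ (sA _ _ h)) (sub _ (sA _ _ yx)) ei.
have := arcs_del v es.
have := IH (A :\ v) (del e v) _ A1 (del_sym v es) (del_irr v ei) (del_supported es sA)
  (cycles_ok_sub (@del_sub _ e v) ok).
by lia.
Qed.

(** The shared edge is counted once, so at most 6 + 4 arcs disappear with two vertices. *)
Lemma bound_adjacent n A e u v : bounded n -> #|A| <= n.+1 -> symmetric e -> irreflexive e ->
  supported A e -> cycles_ok e -> (forall w, w \in A -> 2 < #|nbr e w|) -> e u v ->
  #|nbr e u| <= 3 -> #|nbr e v| <= 3 -> arcs e <= 5 * #|A|.-1.
Proof.
move=> IH An es ei sA ok d3 uv du dv.
have vu : e v u by rewrite es.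
have uA := sA _ _ uv; have vA := sA _ _ vu.
have cA : #|A| = (#|A :\ u|).+1 by rewrite (cardsD1 u A) uA.
have vA' : v \in A :\ u by rewrite !inE vA andbT; apply/eqP => h; rewrite h ei in uv.
have cA' : #|A :\ u| = (#|A :\ u :\ v|).+1 by rewrite (cardsD1 v (A :\ u)) vA'.
have pos : 0 < #|A :\ u :\ v|.
  have : #|nbr e u| <= #|A :\ u|.
    apply: subset_leq_card; apply/subsetP => w; rewrite !inE => h.
    have h2 := h; rewrite es in h2.
    by rewrite (sA _ _ h2) andbT; apply/eqP => h'; rewrite h' ei in h.
  by have := d3 u uA; lia.
have d1 := arcs_del u es; have d2 := arcs_del v (del_sym u es).
have dv' : #|nbr (del e u) v| <= 2.
  have := subset_leq_card (nbr_del e u v); have := cardsD1 u (nbr e v).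
  by rewrite inE vu; lia.
have := IH (A :\ u :\ v) (del (del e u) v) _ pos (del_sym _ (del_sym _ es)) (del_irr _ (del_irr _ ei))
  (del_supported (del_sym _ es) (del_supported es sA))
  (cycles_ok_sub (@del_sub _ _ v) (cycles_ok_sub (@del_sub _ e u) ok)).
by lia.
Qed.

(** Deleting the four vertices in turn removes at most 4, 3, 2 and 1 edges: 20 arcs, exactly the
    drop of the bound. *)
Lemma bound_block n A e : bounded n -> #|A| <= n.+1 -> symmetric e -> irreflexive e ->
  supported A e -> cycles_ok e -> small_block e -> arcs e <= 5 * #|A|.-1.
Proof.
move=> IH An es ei sA ok [a [b [c [d [r [uq cyc sub]]]]]].
have [ab bc cd dr ra] : [/\ e a b, e b c, e c d, e d r & e r a].
  by move: cyc; rewrite /= => /and5P[-> -> -> -> /andP[-> _]].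
have [aA bA cA dA rA] : [/\ a \in A, b \in A, c \in A, d \in A & r \in A].
  by split; [exact: sA ab|exact: sA bc|exact: sA cd|exact: sA dr|exact: sA ra].
pose e1 := del e a; pose e2 := del e1 b; pose e3 := del e2 c; pose e4 := del e3 d.
have s1 : symmetric e1 := del_sym a es; have s2 : symmetric e2 := del_sym b s1.
have s3 : symmetric e3 := del_sym c s2; have s4 : symmetric e4 := del_sym d s3.
have i4 : irreflexive e4 := del_irr d (del_irr c (del_irr b (del_irr a ei))).
have A4 : supported (A :\ a :\ b :\ c :\ d) e4.
  by do 4! apply: del_supported => //.
have ok4 : cycles_ok e4.
  by do 4! (apply: cycles_ok_sub; first exact: del_sub).
have cards : #|A| = (#|A :\ a :\ b :\ c :\ d| + 4)%N /\ 0 < #|A :\ a :\ b :\ c :\ d|.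
  move: uq; rewrite /= !inE !negb_or => /and5P[/and4P[n1 n2 n3 n4] /and3P[n5 n6 n7] /andP[n8 n9] n10 _].
  split; last first.
    by apply/card_gt0P; exists r; rewrite !inE rA !(eq_sym r) n10 n9 n7 n4.
  rewrite (cardsD1 a A) aA (cardsD1 b (A :\ a)) !inE bA (eq_sym b a) n1.
  rewrite (cardsD1 c (A :\ a :\ b)) !inE cA (eq_sym c a) (eq_sym c b) n2 n5.
  rewrite (cardsD1 d (A :\ a :\ b :\ c)) !inE dA (eq_sym d a) (eq_sym d b) (eq_sym d c) n3 n6 n8 /= !add1n.
  by rewrite addn4.
have D1 : #|nbr e a| <= 4.
  have : nbr e a \subset [:: b; c; d; r].
    apply/subsetP => v; rewrite inE => h; have := sub a _ v h; rewrite !inE eqxx => /(_ isT).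
    by case/orP => // /eqP va; rewrite va ei in h.
  by move=> /subset_leq_card /leq_trans; apply; apply: (leq_trans (card_size _)).
have D2 : #|nbr e1 b| <= 3.
  have : nbr e1 b \subset [:: c; d; r].
    apply/subsetP => v; rewrite inE => /and3P[h _ va]; have := sub b _ v h; rewrite !inE eqxx orbT => /(_ isT).
    rewrite (negPf va) /=; by case/orP => // /eqP vb; rewrite vb ei in h.
  by move=> /subset_leq_card /leq_trans; apply; apply: (leq_trans (card_size _)).
have D3 : #|nbr e2 c| <= 2.
  have : nbr e2 c \subset [:: d; r].
    apply/subsetP => v; rewrite inE => /and3P[/and3P[h _ va] _ vb]; have := sub c _ v h; rewrite !inE eqxx !orbT => /(_ isT).
    rewrite (negPf va) (negPf vb) /=; by case/orP => // /eqP vc; rewrite vc ei in h.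
  by move=> /subset_leq_card /leq_trans; apply; apply: (leq_trans (card_size _)).
have D4 : #|nbr e3 d| <= 1.
  have : nbr e3 d \subset [:: r].
    apply/subsetP => v; rewrite inE => /and3P[/and3P[/and3P[h _ va] _ vb] _ vc]; have := sub d _ v h; rewrite !inE eqxx !orbT => /(_ isT).
    rewrite (negPf va) (negPf vb) (negPf vc) /=; by case/orP => // /eqP vd; rewrite vd ei in h.
  by move=> /subset_leq_card /leq_trans; apply; apply: (leq_trans (card_size _)).
have := arcs_del a es; have := arcs_del b s1; have := arcs_del c s2; have := arcs_del d s3.
have [cA4 p4] := cards.
have := IH _ e4 _ p4 s4 i4 A4 ok4.
rewrite -/e1 -/e2 -/e3 -/e4; move: (arcs e) (arcs e1) (arcs e2) (arcs e3) (arcs e4) D1 D2 D3 D4 cA4 An p4.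
clear; lia.
Qed.

(** Deleting [p] and [q] removes at most 12 arcs. Identifying two vertices costs at most 2 more, for
    a total of 14 against 15; identifying three costs at most 6 more, for a total of 18 against
    20. *)
Lemma bound_twins n A e : bounded n -> #|A| <= n.+1 -> symmetric e -> irreflexive e ->
  supported A e -> cycles_ok e -> twin_pair e -> arcs e <= 5 * #|A|.-1.
Proof.
move=> IH An es ei sA ok [p [q [x [y [p' [q' [r [pq xy np nq [pr lr rn]]]]]]]]].
have nE w v : (v \in nbr e w) = e w v by rewrite inE.
have [px py pp'] : [/\ e p x, e p y & e p p'] by rewrite -!nE np !inE !eqxx ?orbT.
have [qx qy qq'] : [/\ e q x, e q y & e q q'] by rewrite -!nE nq !inE !eqxx ?orbT.
have := rn p'; rewrite inE eqxx => /(_ isT); rewrite !inE !negb_or => /and4P[p'p p'q p'x p'y].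
have := rn q'; rewrite -{1}lr mem_last => /(_ isT); rewrite !inE !negb_or => /and4P[q'p q'q q'x q'y].
have xp : x != p by apply/eqP => h; rewrite h ei in px.
have yp : y != p by apply/eqP => h; rewrite h ei in py.
have xq : x != q by apply/eqP => h; rewrite h ei in qx.
have yq : y != q by apply/eqP => h; rewrite h ei in qy.
have xA : x \in A by apply: (sA x p); rewrite es.
have yA : y \in A by apply: (sA y p); rewrite es.
have p'A : p' \in A by apply: (sA p' p); rewrite es.
have q'A : q' \in A by apply: (sA q' q); rewrite es.
have pA := sA _ _ px; have qA := sA _ _ qx.
pose e1 := del e p; pose h := del e1 q; pose B := A :\ p :\ q.
have s1 : symmetric e1 := del_sym p es; have sh : symmetric h := del_sym q s1.
have ih : irreflexive h := del_irr q (del_irr p ei).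
have sB : supported B h by apply: del_supported => //; apply: del_supported.
have he u v : h u v -> e u v by move=> /del_sub /del_sub.
have okh : cycles_ok h := cycles_ok_sub he ok.
have cB : #|A| = #|B|.+2.
  have q1 : q \in A :\ p by rewrite !inE qA eq_sym andbT; apply/eqP.
  by rewrite (cardsD1 p A) pA (cardsD1 q (A :\ p)) q1.
have c3 (a b c : T) : #|[set a; b; c]| <= 3.
  by rewrite -setUA cardsU1 cards2; case: (_ \notin _); case: (_ != _).
have np3 : #|nbr e p| <= 3 by rewrite np.
have nq3 : #|nbr e1 q| <= 3.
  apply: (leq_trans (subset_leq_card (nbr_del e p q))).
  by apply: (leq_trans (subset_leq_card (subsetDl _ _))); rewrite nq.
have arcs_h : arcs e <= arcs h + 12.
  by have := arcs_del p es; have := arcs_del q s1; rewrite -/e1 -/h; move: np3 nq3; clear; lia.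
have out u s : path h u s -> (p \notin s) && (q \notin s).
  move=> ps; rewrite (del_path_notin ps) andbT.
  by apply: (@del_path_notin _ e p u); apply: sub_path ps => ? ?; apply: del_sub.
have path_e u s : path h u s -> path e u s by apply: sub_path.
have finish (Z : {set T}) z : z \in Z -> Z \subset B -> #|Z| = 3 \/ #|Z| = 2 ->
    (forall z1 z2 s, z1 \in Z -> z2 \in Z -> z1 <> z2 -> path h z1 (rcons s z2) ->
       uniq s -> {in s, forall v, v \notin Z} -> (size s).+1 %% 4 <> 2) -> arcs e <= 5 * #|A|.-1.
  move=> zZ ZB cZ noZ.
  have zB := subsetP ZB z zZ.
  have cZ1 : #|Z| = #|Z :\ z|.+1 by rewrite (cardsD1 z Z) zZ.
  have cD : #|B :\: (Z :\ z)| = #|B| - #|Z :\ z|.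
    rewrite cardsD; congr (_ - _); apply: eq_card => v; rewrite !inE.
    by case: (boolP (v \in Z)) => [/(subsetP ZB)|]; rewrite ?inE ?andbF //= => ->; rewrite andbT.
  have pos : 0 < #|B :\: (Z :\ z)| by apply/card_gt0P; exists z; rewrite !inE eqxx /=; move: zB; rewrite !inE.
  have b1 := arcs_collapse sh ih zZ noZ.
  have := IH (B :\: (Z :\ z)) (collapse h Z z) _ pos (collapse_sym _ _ sh) (@collapse_irr _ _ _ _)
     (collapse_supported zZ sB ZB) (collapse_ok sh okh zZ noZ).
  move: cB cZ cZ1 cD pos b1 arcs_h An; clear.
  move: (arcs e) (arcs h) (arcs _) #|A| #|B| #|Z| #|Z :\ z| #|B :\: _| => ae ah ac a b z0 z1 d.
  by move=> -> [] -> [<-] -> pos b1 arcs_h An IH'; have := IH' _; lia.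
have [pq'|npq] := eqVneq p' q'.
  subst q'; apply: (finish [set x; y; p'] p').
  - by rewrite !inE eqxx orbT.
  - by apply/subsetP => v; rewrite !inE => /orP[/orP[]|] /eqP ->; rewrite ?xA ?yA ?p'A ?xp ?xq ?yp ?yq ?p'p ?p'q.
  - left; rewrite -setUA cardsU1 cards2 !inE negb_or (eq_sym x p') (eq_sym y p') p'x p'y.
    by have -> : x != y by apply/eqP.
  move=> z1 z2 s z1Z z2Z n12 ps us sZ.
  (* Both [p] and [q] are adjacent to all of [Z], so the vertex of [Z] other than [z1] and [z2]
     provides the detour of [twins_close]. *)
  have [t tZ [t1 t2]] : exists2 t, t \in [set x; y; p'] & t <> z1 /\ t <> z2.
    have xp' : x <> p' by apply/eqP; rewrite eq_sym.
    have yp' : y <> p' by apply/eqP; rewrite eq_sym.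
    move: z1Z z2Z; rewrite !inE => /orP[/orP[]|] /eqP e1' /orP[/orP[]|] /eqP e2'; subst z1 z2; try by case: n12.
    - by exists p'; rewrite ?inE ?eqxx ?orbT //; split; auto.
    - by exists y; rewrite ?inE ?eqxx ?orbT //; split; auto.
    - by exists p'; rewrite ?inE ?eqxx ?orbT //; split; auto.
    - by exists x; rewrite ?inE ?eqxx ?orbT //; split; auto.
    - by exists y; rewrite ?inE ?eqxx ?orbT //; split; auto.
    - by exists x; rewrite ?inE ?eqxx ?orbT //; split; auto.
  have [ns1 ns2] : p \notin s /\ q \notin s.
    have := out _ _ ps; rewrite !mem_rcons !inE !negb_or => /andP[/andP[_ ->] /andP[_ ->]]; by [].
  have pZ w : w \in [set x; y; p'] -> e p w by rewrite -nE np.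
  have qZ w : w \in [set x; y; p'] -> e q w by rewrite -nE nq -pq'.
  apply: (@twins_close _ e es ei ok p q t z1 z2 s) => //; try by [apply: pZ|apply: qZ].
  - by move=> h'; have := pZ _ z2Z; rewrite -h' ei.
  - by move=> h'; have := qZ _ z1Z; rewrite -h' ei.
  - exact: path_e.
  - rewrite /= rcons_uniq us mem_rcons inE negb_or andbT; apply/andP; split; first (apply/andP; split); first by apply/eqP.
      by apply: contraL z1Z => h'; exact: sZ.
    by apply: contraL z2Z => h'; exact: sZ.
  by apply: contraL tZ => h'; exact: sZ.
apply: (finish [set p'; q'] p').
- by rewrite !inE eqxx.
- by apply/subsetP => v; rewrite !inE => /orP[] /eqP ->; rewrite ?p'A ?q'A ?p'p ?p'q ?q'p ?q'q.
- by right; rewrite cards2 npq.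
have far s : path h p' (rcons s q') -> uniq s -> {in s, forall v, v \notin [set p'; q']} -> (size s).+1 %% 4 <> 2.
  move=> ps us sZ.
  have [ns1 ns2] : p \notin s /\ q \notin s.
    have := out _ _ ps; rewrite !mem_rcons !inE !negb_or => /andP[/andP[_ ->] /andP[_ ->]]; by [].
  apply: (@twins_far _ e es ei ok p q x y p' q' r s) => //; first exact: path_e.
  rewrite /= rcons_uniq us mem_rcons inE negb_or npq andbT /=; apply/andP; split.
    by apply/negP => /sZ; rewrite !inE eqxx.
  by apply/negP => /sZ; rewrite !inE eqxx orbT.
move=> z1 z2 s; rewrite !inE => /orP[] /eqP -> /orP[] /eqP -> n12 ps us sZ; try by case: n12.
  exact: far.
rewrite -(size_rev s); apply: far; rewrite ?rev_uniq //; last by move=> v; rewrite mem_rev; apply: sZ.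
have := rev_path h q' (rcons s p'); rewrite last_rcons belast_rcons rev_cons => ->.
by rewrite (eq_path (e' := h)) // => u v; rewrite sh.
Qed.

Theorem arcs_bound n : bounded n.
Proof.
elim: n => [|n IH] A e An A0 es ei sA ok; first by move: A0; rewrite ltnNge An.
have [[v vA dv]|hd] : (exists2 v, v \in A & #|nbr e v| <= 2) \/ (forall v, v \in A -> 2 < #|nbr e v|).
  have [/existsP[v /andP[vA dv]]|/existsPn h] := boolP [exists v, (v \in A) && (#|nbr e v| <= 2)].
    by left; exists v.
  by right=> v vA; have := h v; rewrite vA /= -ltnNge.
  exact: (bound_small_degree IH An es ei sA ok vA dv).
have [/existsP[u /existsP[v /and3P[uv du dv]]]|h] :=
  boolP [exists u, exists v, [&& e u v, #|nbr e u| <= 3 & #|nbr e v| <= 3]].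
  exact: (bound_adjacent IH An es ei sA ok hd uv du dv).
have /card_gt0P[v vA] := A0.
have /card_gt0P[u] : 0 < #|nbr e v| by apply: leq_trans (hd v vA).
rewrite inE => vu.
case: (twin_pair_or_small_block es ei ok _ _ vu).
- by move=> x y xy; apply: hd; apply: sA xy.
- move=> x y xy; move: h; rewrite negb_exists => /forallP/(_ x); rewrite negb_exists => /forallP/(_ y).
  by rewrite xy /= negb_and -!ltnNge => /orP.
- exact: (bound_twins IH An es ei sA ok).
- exact: (bound_block IH An es ei sA ok).
Qed.
End Bound.

(** * Edges and ordered pairs *)

Section Edges.
Variable G : sgraph.

Lemma edge_inj (a b c d : G) : [set a; b] = [set c; d] -> (a, b) = (c, d) \/ (a, b) = (d, c).
Proof.
move=> h.
have : a \in [set c; d] by rewrite -h !inE eqxx.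
have : b \in [set c; d] by rewrite -h !inE eqxx orbT.
have : c \in [set a; b] by rewrite h !inE eqxx.
have : d \in [set a; b] by rewrite h !inE eqxx orbT.
rewrite !inE => /orP[] /eqP-> /orP[] /eqP -> /orP[] /eqP hb /orP[] /eqP ha; auto.
all: try by left; congr pair.
all: try by right; congr pair.
Qed.

(** Without loops, each edge is the image of exactly two ordered pairs. *)
Lemma double_edges : 2 * #|edges G| = arcs (@adj G).
Proof.
rewrite /edges /arcs; set D := [set p | _]; set f := (fun p => _).
rewrite -[RHS]sum1_card (partition_big_imset f) /= -sum1_card big_distrr /=.
apply: eq_bigr => E /imsetP[[a b]]; rewrite inE /= => ab ->.
rewrite muln1 sum1_card; symmetry.
have -> : #|[pred p in D | f p == f (a, b)]| = #|[set (a, b); (b, a)]|.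
  apply: eq_card => -[c d]; rewrite !inE /=; apply/idP/idP.
    by move=> /andP[_ /eqP /edge_inj [] ->]; rewrite eqxx ?orbT.
  by case/orP => /eqP[-> ->]; rewrite 1?(adj_sym b) ab /f /= ?eqxx // setUC eqxx.
rewrite cards2; case: eqP => // -[h _]; move: ab; rewrite h adj_irrefl //.
Qed.
End Edges.

Lemma sum_degree (T : finType) (e : rel T) : arcs e = \sum_u #|nbr e u|.
Proof.
rewrite /arcs -sum1_card (eq_bigl (fun p => xpredT p.1 && e p.1 p.2)); last by move=> p; rewrite inE.
rewrite -(pair_big_dep xpredT e (fun _ _ => 1)) /=.
by apply: eq_bigr => u _; rewrite sum1_card; apply: eq_card => v; rewrite inE.
Qed.

(** * The extremal graphs *)

Section Windmill.
Variable t : nat.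

(* None is the common vertex of the t copies of K_5. *)
Definition windmill_vertex : finType := option ('I_t * 'I_4).

Definition windmill_adj : rel windmill_vertex := fun u v => (u != v) &&
  match u, v with Some x, Some y => x.1 == y.1 | _, _ => true end.

Lemma windmill_sym : symmetric windmill_adj.
Proof. by move=> [x|] [y|] //; rewrite /windmill_adj eq_sym (eq_sym x.1). Qed.

Lemma windmill_irr : irreflexive windmill_adj.
Proof. by move=> u; rewrite /windmill_adj eqxx. Qed.

Definition windmill := SGraph windmill_sym windmill_irr.

Lemma windmill_card : #|windmill| = (4 * t).+1.
Proof. by rewrite card_option card_prod !card_ord mulnC. Qed.

(** The degree sum is [4 * t] at the centre plus 4 at each of the other [4 * t] vertices. *)
Lemma windmill_edges : #|edges windmill| = 10 * t.
Proof.
apply/eqP; rewrite -(eqn_pmul2l (isT : 0 < 2)) double_edges sum_degree.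
rewrite (bigD1 None) //=.
have -> : #|nbr windmill_adj None| = 4 * t.
  have -> : nbr windmill_adj None = Some @: setT.
    by apply/setP => -[x|]; rewrite !inE /windmill_adj /=; [rewrite mem_imset ?inE //; exact: Some_inj|apply/esym/negP => /imsetP[]].
  by rewrite card_imset ?cardsT ?card_prod ?card_ord 1?mulnC //; exact: Some_inj.
rewrite (eq_bigr (fun=> 4)) => [|[[i a]|] // _].
  rewrite sum_nat_const.
  have -> : #|[pred u : windmill_vertex | u != None]| = 4 * t.
    have cT : #|windmill_vertex| = (4 * t).+1 := windmill_card.
    have := cardC (pred1 (None : windmill_vertex)); rewrite card1 cT add1n => -[<-].
    by apply: eq_card.
  by rewrite mulnC mulnA; apply/eqP; lia.
have -> : nbr windmill_adj (Some (i, a)) = None |: [set Some (i, b) | b in [set~ a]].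
  apply/setP => -[[j b]|]; rewrite !inE /windmill_adj /=; last by [].
  apply/idP/imsetP => [/andP[ne /eqP ij]|[c ca [-> ->]]].
    by exists b; rewrite ?ij // !inE; apply: contra ne => /eqP ->; rewrite ij.
  by rewrite eqxx andbT; apply: contraL ca => /eqP[->]; rewrite !inE eqxx.
rewrite cardsU1 card_imset; last by move=> b c [].
by rewrite cardsC1 card_ord; case: imsetP => [[]|].
Qed.

Lemma windmill_block (x : 'I_t * 'I_4) (r : seq windmill_vertex) : path windmill_adj (Some x) r -> None \notin r ->
  {subset r <= [seq Some (x.1, a) | a <- enum 'I_4]}.
Proof.
elim: r x => // -[y|] r IH x; last by rewrite inE eqxx.
rewrite inE => /andP[/andP[_ /eqP xy] p] nr v.
rewrite inE => /orP[/eqP ->|vr]; last by rewrite xy; apply: IH vr.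
by apply/mapP; exists y.2; rewrite ?mem_enum // xy -surjective_pairing.
Qed.

(** A cycle meets the centre at most once, and what is left of it is a path inside one copy. *)
Lemma windmill_cycle s : uniq s -> cycle windmill_adj s -> 2 < size s -> size s <= 5.
Proof.
move=> us cs sz.
suff [i sub] : exists i : 'I_t, {subset s <= None :: [seq Some (i, a) | a <- enum 'I_4]}.
  by have := uniq_leq_size us sub; rewrite /= size_map size_enum_ord.
have blk x r : cycle windmill_adj (Some x :: r) -> None \notin r ->
    {subset Some x :: r <= [seq Some (x.1, a) | a <- enum 'I_4]}.
  rewrite /= rcons_path => /andP[p _] nr v; rewrite inE => /orP[/eqP->|vr]; last exact: (windmill_block p).
  by apply/mapP; exists x.2; rewrite ?mem_enum // -surjective_pairing.
have [ns|ns] := boolP (None \in s); last first.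
  case: s us cs sz ns => [|[x|] r] // us cs sz; rewrite inE /= => nr; exists x.1 => v vr.
  by rewrite inE (blk x r) ?orbT.
have [i r rs] := rot_to ns.
have cr : cycle windmill_adj (None :: r) by rewrite -rs rot_cycle.
have ur : uniq (None :: r) by rewrite -rs rot_uniq.
have sr : 2 < size (None :: r) by rewrite -rs size_rot.
case: r cr ur sr rs => [|[x|] r] // cr ur sr rs.
exists x.1 => v; rewrite -(mem_rot i) rs inE => /orP[/eqP->|]; first by rewrite inE eqxx.
have nr : None \notin r by move: ur; rewrite /= inE => /andP[].
have px : path windmill_adj (Some x) r by move: cr; rewrite /= rcons_path => /andP[].
rewrite !inE => /orP[/eqP->|vr].
  by apply/orP; right; apply/mapP; exists x.2; rewrite ?mem_enum // -surjective_pairing.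
by rewrite (windmill_block px) ?orbT.
Qed.

Lemma windmill_no_cycle : ~ has_cycle_mod 2 4 windmill.
Proof.
move=> [s [/andP[cs us] sz]].
have := windmill_cycle us cs sz; move: (size s) sz.
by do 6! case=> //.
Qed.

End Windmill.

(** * The value of the constant *)

Local Open Scope ring_scope.

Theorem corollary4 (R : realType) : is_cycle_mod_constant 2 4 (5 / 2 : R).
Proof.
split.
  move=> n G n1 Gn le; apply: Classical_Prop.NNPP => no.
  have ok : cycles_ok (@adj G).
    by move=> s us cs sz h; apply: no; exists s; rewrite // /is_cycle /ucycle cs us.
  have := @arcs_bound G n [set: G] (@adj G); rewrite cardsT Gn -double_edges => /(_ _ _ (@adj_sym G) (@adj_irrefl G) _ ok).
  move=> /(_ (leqnn _) n1 (fun _ _ _ => in_setT _)) b.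
  (* Strict because the bound is [5 * n.-1] and [n] is positive; hence [5 / 2] itself forces a
     cycle. *)
  have : (2 * #|edges G| < 5 * n)%N by lia.
  rewrite -(ltr_nat R) !natrM; move: le; clear; move: (#|edges G|%:R : R) (n%:R : R) => x y; lra.
move=> c' fc; rewrite leNgt; apply/negP => lt.
have [t ht] : exists t : nat, c' * (4 * t).+1%:R <= (10 * t)%:R.
  (* The inequality sought amounts to [c' <= d * t], which holds once [t] exceeds [|c'| / d]. *)
  pose d := 10 - 4 * c'; have d0 : 0 < d by rewrite /d; lra.
  exists (Num.bound (`|c'| / d)).
  have := archi_boundP (divr_ge0 (normr_ge0 c') (ltW d0)); set t := Num.bound _.
  rewrite ltr_pdivrMr // => h; have := ler_norm c'.
  rewrite -addn1 natrD !natrM /d in h *; nra.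
by apply: (@windmill_no_cycle t); apply: (fc _ (windmill t) _ (windmill_card t)); rewrite ?windmill_edges.
Qed.
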